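(* Let $(G_n)$ be a sequence of weighted graphs with nodeweights $1$, edgeweights in $[-1,1]$, and $|V(G_n)|\to\infty$ as $n\to\infty$. Then $(G_n)$ is left-convergent if and only if for every $\varepsilon>0$ there exist an integer $q\le 2^{10/\varepsilon^2}$ and a sequence $(\mathcal P_n)$, with $\mathcal P_n$ a partition of $V(G_n)$, such that the following two conditions hold. (i) If $|V(G_n)|\ge q$, then $\mathcal P_n$ is a weakly $\varepsilon$-regular partition of $G_n$ into $q$ classes. (ii) As $n\to\infty$, the quotient graphs $G_n/\mathcal P_n$ converge to a weighted graph $H_\varepsilon$ on $q$ nodes.
   Context: A weighted graph $G$ is a finite graph with nonempty node set $V(G)$, a weight $\alpha_i=\alpha_i(G)>0$ for each node $i$, and a real weight $\beta_{ij}=\beta_{ij}(G)=\beta_{ji}(G)$ for each edge $ij$ (loops $i=j$ are allowed); one sets $\beta_{ij}=0$ if $ij$ is not an edge. Put $\alpha_G=\sum_i\alpha_i(G)$ and, for $S,T\subseteq V(G)$, $e_G(S,T)=\sum_{i\in S,\,j\in T}\alpha_i\alpha_j\beta_{ij}$. A simple graph is a finite graph without loops or multiple edges. For a simple graph $F$ on $k$ nodes, $t(F,G)=\alpha_G^{-k}\sum_{\phi:V(F)\to V(G)}\prod_{i\in V(F)}\alpha_{\phi(i)}(G)\prod_{ij\in E(F)}\beta_{\phi(i)\phi(j)}(G)$. A sequence $(G_n)$ of weighted graphs with uniformly bounded edgeweights is left-convergent if $t(F,G_n)$ converges for every simple graph $F$. If $G,G'$ are weighted graphs on the same node set $V$ with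 the same nodeweights, $d_\square(G,G')=\max_{S,T\subseteq V}\frac{1}{\alpha_G^2}|e_G(S,T)-e_{G'}(S,T)|$. For a partition $\mathcal P=\{V_1,\dots,V_k\}$ of $V(G)$ (classes labeled $1,\dots,k$) put $\alpha_{V_i}=\sum_{x\in V_i}\alpha_x(G)$. The quotient graph $G/\mathcal P$ is the weighted graph on $[k]=\{1,\dots,k\}$ with nodeweights $\alpha_i(G/\mathcal P)=\alpha_{V_i}/\alpha_G$ and edgeweights $\beta_{ij}(G/\mathcal P)=e_G(V_i,V_j)/(\alpha_{V_i}\alpha_{V_j})$. The graph $G_{\mathcal P}$ is the weighted graph on $V(G)$ with nodeweights $\alpha_x(G)$ and edgeweights $\beta_{xy}(G_{\mathcal P})=\beta_{ij}(G/\mathcal P)$ for $x\in V_i$, $y\in V_j$. The partition $\mathcal P$ is weakly $\varepsilon$-regular if $d_\square(G,G_{\mathcal P})\le\varepsilon$. In (ii), for all large $n$ the quotient graphs have the same node set $[q]$, and convergence means that corresponding nodeweights and edgeweights converge to those of $H_\varepsilon$. *)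

(* Defs.v *)
From HB Require Import structures.
From mathcomp Require Import all_boot all_order all_algebra.
From mathcomp Require Import all_classical all_reals all_analysis.

Set Implicit Arguments.
Unset Strict Implicit.
Unset Printing Implicit Defensive.

Import Order.TTheory GRing.Theory Num.Theory.
Import numFieldNormedType.Exports.

Local Open Scope ring_scope.

(* [beta i j] is 0 when [ij] is not an edge. *)
Record wgraph (R : realType) (V : finType) := WGraph {
  alpha : V -> R ;
  beta : V -> V -> R ;
  wgraph_nonempty : (0 < #|V|)%N ;
  alpha_gt0 : forall i, 0 < alpha i ;
  beta_sym : forall i j, beta i j = beta j i
}.

Record sgraph := SGraph {
  svertex : finType ;
  sedge : rel svertex ;
  sedge_sym : symmetric sedge ;
  sedge_irrefl : irreflexive sedge
}.

Section WeightedGraph.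
Context {R : realType} {V : finType}.
Implicit Types (G : wgraph R V) (S T : {set V}).

Definition alpha_set G S : R := \sum_(x in S) alpha G x.

Definition alpha_tot G : R := \sum_x alpha G x.

Definition edge_mass G S T : R :=
  \sum_(i in S) \sum_(j in T) alpha G i * alpha G j * beta G i j.

(* The comparison of [enum_rank]s makes each unordered edge count once. *)
Definition hom_density (F : sgraph) G : R :=
  (alpha_tot G) ^- #|svertex F| *
  \sum_(phi : {ffun svertex F -> V})
    ((\prod_i alpha G (phi i)) *
     \prod_(e : svertex F * svertex F |
            sedge e.1 e.2 && (enum_rank e.1 < enum_rank e.2)%N)
        beta G (phi e.1) (phi e.2)).

(* Meant for graphs with the same nodeweights, so that [alpha_tot G] and
   [alpha_tot G'] agree. The values are nonnegative, hence the unit 0. *)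
Definition cut_dist G G' : R :=
  \big[Num.max/0]_(S : {set V}) \big[Num.max/0]_(T : {set V})
    (`|edge_mass G S T - edge_mass G' S T| / alpha_tot G ^+ 2).

Lemma edge_massC G S T : edge_mass G S T = edge_mass G T S.
Proof.
rewrite /edge_mass exchange_big; apply: eq_bigr => i _; apply: eq_bigr => j _.
by rewrite beta_sym (mulrC (alpha G j)).
Qed.

Lemma alpha_set_gt0 G S x : x \in S -> 0 < alpha_set G S.
Proof.
move=> xS; rewrite /alpha_set (bigD1 x) //= ltr_pwDl ?alpha_gt0 //.
by apply: sumr_ge0 => y _; rewrite ltW ?alpha_gt0.
Qed.

Lemma alpha_tot_gt0 G : 0 < alpha_tot G.
Proof.
have /card_gt0P[x _] := wgraph_nonempty G.
rewrite /alpha_tot (bigD1 x) //= ltr_pwDl ?alpha_gt0 //.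
by apply: sumr_ge0 => y _; rewrite ltW ?alpha_gt0.
Qed.

End WeightedGraph.

(* A partition into [nclass] nonempty classes labeled by ['I_nclass], given by
   the surjection sending a node to the label of its class. *)
Record lpartition (V : finType) := LPartition {
  nclass : nat ;
  label : V -> 'I_nclass ;
  label_surj : forall i, exists x, label x = i
}.

Definition pclass (V : finType) (P : lpartition V) (i : 'I_(nclass P)) :
  {set V} := [set x | label P x == i]%SET.

Lemma pclass_partition (V : finType) (P : lpartition V) :
  finset.partition (pclass (P := P) @: [set: 'I_(nclass P)])%SET [set: V]%SET.
Proof.
apply/and3P; split.
- apply/eqP/setP => x; rewrite inE; apply/bigcupP.
  by exists (pclass (label P x)); rewrite ?imset_f ?inE.
- apply/finset.trivIsetP => _ _ /imsetP[i _ ->] /imsetP[j _ ->] neq_ij.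
  rewrite -setI_eq0; apply/eqP/setP => x; rewrite !inE.
  apply/negP => /andP[/eqP xi /eqP xj].
  by move: neq_ij; rewrite -xi -xj eqxx.
- apply/imsetP => -[i _ /esym/setP Pi0].
  by have [x xi] := label_surj i; have := Pi0 x; rewrite !inE xi eqxx.
Qed.

Lemma pclass_inj (V : finType) (P : lpartition V) : injective (pclass (P := P)).
Proof.
move=> i j /setP eq_ij; have [x xi] := label_surj i.
by have := eq_ij x; rewrite !inE xi eqxx => /esym/eqP.
Qed.

Section Quotient.
Context {R : realType} {V : finType} (G : wgraph R V) (P : lpartition V).

Definition quotient_alpha (i : 'I_(nclass P)) : R :=
  alpha_set G (pclass i) / alpha_tot G.

Definition quotient_beta (i j : 'I_(nclass P)) : R :=
  edge_mass G (pclass i) (pclass j) /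
  (alpha_set G (pclass i) * alpha_set G (pclass j)).

Lemma quotient_nonempty : (0 < #|'I_(nclass P)|)%N.
Proof.
have /card_gt0P[x _] := wgraph_nonempty G.
by apply/card_gt0P; exists (label P x).
Qed.

Lemma quotient_alpha_gt0 i : 0 < quotient_alpha i.
Proof.
have [x xi] := label_surj i.
by rewrite divr_gt0 ?alpha_tot_gt0 // (@alpha_set_gt0 _ _ _ _ x) // inE xi.
Qed.

Lemma quotient_beta_sym i j : quotient_beta i j = quotient_beta j i.
Proof. by rewrite /quotient_beta edge_massC [X in _ / X]mulrC. Qed.

Definition quotient_graph : wgraph R 'I_(nclass P) :=
  WGraph quotient_nonempty quotient_alpha_gt0 quotient_beta_sym.

Definition averaged_graph : wgraph R V :=
  @WGraph R V (alpha G)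
    (fun x y => beta quotient_graph (label P x) (label P y))
    (wgraph_nonempty G) (alpha_gt0 G)
    (fun x y => beta_sym quotient_graph (label P x) (label P y)).

Definition weakly_regular (eps : R) : Prop := cut_dist G averaged_graph <= eps.

End Quotient.

Section Convergence.
Local Open Scope classical_set_scope.

Definition left_convergent (R : realType) (V : nat -> finType)
    (G : forall n, wgraph R (V n)) : Prop :=
  forall F : sgraph, cvgn (fun n => hom_density F (G n)).

(* [kq] identifies the node set ['I_(k n)] with ['I_q] from index [N] on; the
   convergence is that of the tails, since the initial terms may have another
   node set. *)
Definition wgraph_cvg (R : realType) (k : nat -> nat)
    (Q : forall n, wgraph R 'I_(k n)) (q : nat) (H : wgraph R 'I_q) : Prop :=
  exists (N : nat) (kq : forall n, q = k (n + N)%N),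
    (forall i : 'I_q,
       (fun n => alpha (Q (n + N)%N) (cast_ord (kq n) i)) @ \oo
         --> alpha H i) /\
    (forall i j : 'I_q,
       (fun n => beta (Q (n + N)%N) (cast_ord (kq n) i) (cast_ord (kq n) j))
         @ \oo --> beta H i j).

End Convergence.

(* Main.v *)
(** Weakly regular partitions bring every homomorphism density within O(eps) of
    a polynomial in the weights of the quotient (counting lemma), so convergent
    quotients for every eps make the densities Cauchy.

    Conversely, read the edgeweights of [G] as the means of independent random
    signs. The law of the sign matrix on [k] random nodes is a combination of the
    densities t(F, G) with F on [k] nodes, so left convergence makes the laws for
    [G n] and [G m] almost equal. The expectation of the 4-cycle sum of
    "sign - step function" is close to the 4-cycle sum of "[G] - step function",
    and 4-cycle sums control the cut norm in both directions; hence some sign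
    matrix is close, in cut norm and in the frequencies of the labels, to
    Frieze-Kannan step approximations of both graphs. Matching nodes that carry
    the same label yields a nearly measure-preserving map from V(G m) to V(G n)
    along which [G n] pulls back close to [G m], for [n] large and [m] large
    depending on [n]. Regular partitions pull back along it as well, so a cluster
    point of quotients of regular partitions is approached by all later graphs. *)

Require Import Defs.
From HB Require Import structures.
From mathcomp Require Import all_boot all_order all_algebra.
From mathcomp Require Import all_classical all_reals all_analysis.
From mathcomp Require Import ring lra.

Set Implicit Arguments.
Unset Strict Implicit.
Unset Printing Implicit Defensive.

Import Order.TTheory GRing.Theory Num.Theory.
Import numFieldNormedType.Exports.

Local Open Scope ring_scope.

(** * Cut norm *)

Section CutNorm.
Context {R : realFieldType}.

(** Random signs are used because densities of simple graphs see each edge at most once. The law of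
    a sign matrix asks for no more, as squares of signs are 1, and it lives on a finite set, so
    finitely many densities determine it. Sampling the edgeweights themselves would bring in
    multigraphs. One number of classes has to serve all [n], within 2^(10/eps^2). For [t] the
    integer part of 5/eps^2, 4^t labels respect this bound, and [t] energy steps reach error e as
    soon as (t+1) e^2 >= 1. Since 5 (9/20)^2 = 81/80 > 1, e = 9/20 eps is allowed. Replacing the
    step values by averages doubles the error to 9/10 eps, and the remaining eps/10 pays for
    enlarging small classes and for the pullback. Small classes are the obstacle to (ii): an
    edgeweight of the quotient is an average over a product of classes, which closeness in cut norm
    controls only if the class frequencies stay away from 0. The limit also needs positive
    nodeweights. *)

Definition unit_fun (V : finType) (f : V -> R) := forall x, 0 <= f x <= 1.

Definition cut_form (V : finType) (U : V -> V -> R) (f g : V -> R) : R :=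
  \sum_x \sum_y f x * g y * U x y.

(** Unnormalised cut norm, tested on [0,1]-valued functions rather than on sets: averaging over
    classes and summing over fibres turn indicators into multiples of such functions. *)
Definition cut_le (V : finType) (U : V -> V -> R) (M : R) :=
  forall f g, unit_fun f -> unit_fun g -> `|cut_form U f g| <= M.

Lemma unit_fun_indicator (V : finType) (S : {set V}) :
  unit_fun (fun x => (x \in S)%:R).
Proof. by move=> x; case: (x \in S); rewrite ?lexx ?ler01. Qed.

(** The sum is linear in [f], so it is largest at a vertex of the cube, namely the indicator of the
    set where [r] is nonnegative. *)
Lemma ler_unit_sum (V : finType) (f r : V -> R) (M : R) :
  unit_fun f -> (forall S : {set V}, `|\sum_(x in S) r x| <= M) ->
  `|\sum_x f x * r x| <= M.
Proof.
move=> f01 rM.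
have up (r' : V -> R) : (forall S : {set V}, `|\sum_(x in S) r' x| <= M) ->
    \sum_x f x * r' x <= M.
  move=> /(_ [set x | 0 <= r' x]%SET) /(le_trans (ler_norm _)); apply: le_trans.
  rewrite [leRHS]big_mkcond; apply: ler_sum => x _ /=.
  have /andP[f0 f1] := f01 x; rewrite inE.
  case: ifPn => [r0|]; first by rewrite ler_piMl.
  by rewrite -ltNge => /ltW r0; rewrite mulr_ge0_le0.
rewrite ler_norml up // andbT lerNl -sumrN.
under eq_bigr do rewrite -mulrN.
by apply: up => S; rewrite sumrN normrN.
Qed.

Lemma cut_le_set (V : finType) (U : V -> V -> R) (M : R) :
  (forall S T : {set V}, `|\sum_(x in S) \sum_(y in T) U x y| <= M) ->
  cut_le U M.
Proof.
move=> UM f g f01 g01; rewrite /cut_form.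
under eq_bigr => x _ do (under eq_bigr => y _ do rewrite -mulrA; rewrite -mulr_sumr).
apply: ler_unit_sum => // S; rewrite exchange_big /=.
under eq_bigr => y _ do rewrite -mulr_sumr.
apply: ler_unit_sum => // T; rewrite exchange_big /=; exact: UM.
Qed.

Lemma cut_form_indicator (V : finType) (U : V -> V -> R) (S T : {set V}) :
  cut_form U (fun x => (x \in S)%:R) (fun x => (x \in T)%:R) =
  \sum_(x in S) \sum_(y in T) U x y.
Proof.
rewrite /cut_form [RHS]big_mkcond; apply: eq_bigr => x _.
case: (x \in S); last by rewrite big1 // => y _; rewrite !mul0r.
rewrite [RHS]big_mkcond; apply: eq_bigr => y _.
by case: (y \in T); rewrite !mul1r ?mul0r.
Qed.

Lemma cut_leP (V : finType) (U : V -> V -> R) (M : R) (S T : {set V}) :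
  cut_le U M -> `|\sum_(x in S) \sum_(y in T) U x y| <= M.
Proof. by rewrite -cut_form_indicator => -> //; apply: unit_fun_indicator. Qed.

Lemma cut_formD (V : finType) (U U' : V -> V -> R) f g :
  cut_form (fun x y => U x y + U' x y) f g = cut_form U f g + cut_form U' f g.
Proof.
rewrite /cut_form -big_split; apply: eq_bigr => x _.
by rewrite -big_split; apply: eq_bigr => y _ /=; rewrite mulrDr.
Qed.

Lemma cut_form_ext (V : finType) (U U' : V -> V -> R) f g :
  (forall x y, U x y = U' x y) -> cut_form U f g = cut_form U' f g.
Proof.
by move=> eqU; apply: eq_bigr => x _; apply: eq_bigr => y _; rewrite eqU.
Qed.

Lemma cut_le_ext (V : finType) (U U' : V -> V -> R) (M : R) :
  (forall x y, U x y = U' x y) -> cut_le U M -> cut_le U' M.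
Proof. by move=> eqU UM f g f01 g01; rewrite -(cut_form_ext f g eqU) UM. Qed.

Lemma cut_le_trans (V : finType) (U : V -> V -> R) (M M' : R) :
  M <= M' -> cut_le U M -> cut_le U M'.
Proof. by move=> MM' UM f g f01 g01; apply: le_trans (UM _ _ f01 g01) MM'. Qed.

Lemma cut_leD (V : finType) (U U' : V -> V -> R) (M M' : R) :
  cut_le U M -> cut_le U' M' -> cut_le (fun x y => U x y + U' x y) (M + M').
Proof.
move=> UM UM' f g f01 g01; rewrite cut_formD.
by rewrite (le_trans (ler_normD _ _)) // lerD ?UM ?UM'.
Qed.

Lemma cut_leN (V : finType) (U : V -> V -> R) (M : R) :
  cut_le U M -> cut_le (fun x y => - U x y) M.
Proof.
move=> UM f g f01 g01; rewrite -normrN; suff -> : - cut_form (fun x y => - U x y) f g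
  = cut_form U f g by exact: UM.
rewrite /cut_form -sumrN; apply: eq_bigr => x _.
by rewrite -sumrN; apply: eq_bigr => y _; rewrite mulrN opprK.
Qed.

Lemma cut_leB (V : finType) (A B C : V -> V -> R) (M M' : R) :
  cut_le (fun x y => A x y - B x y) M -> cut_le (fun x y => B x y - C x y) M' ->
  cut_le (fun x y => A x y - C x y) (M + M').
Proof.
move=> AB BC; apply: cut_le_ext (cut_leD AB BC) => x y /=.
by rewrite addrA subrK.
Qed.

Lemma cut_le_sub (V : finType) (A B : V -> V -> R) (M : R) :
  cut_le (fun x y => A x y - B x y) M -> cut_le (fun x y => B x y - A x y) M.
Proof. by move=> /cut_leN; apply: cut_le_ext => x y; rewrite opprB. Qed.

Lemma cut_le_sum (V : finType) (U : V -> V -> R) (M : R) :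
  \sum_x \sum_y `|U x y| <= M -> cut_le U M.
Proof.
move=> UM f g f01 g01; apply: le_trans UM.
rewrite (le_trans (ler_norm_sum _ _ _)) // ler_sum // => x _.
rewrite (le_trans (ler_norm_sum _ _ _)) // ler_sum // => y _.
rewrite normrM ler_piMl // normrM mulr_ile1 //.
  by have /andP[? ?] := f01 x; rewrite ger0_norm.
by have /andP[? ?] := g01 y; rewrite ger0_norm.
Qed.

Lemma cut_formBl (V : finType) (U : V -> V -> R) f f' g :
  cut_form U (fun x => f x - f' x) g = cut_form U f g - cut_form U f' g.
Proof.
rewrite /cut_form -sumrB; apply: eq_bigr => x _.
by rewrite -sumrB; apply: eq_bigr => y _ /=; rewrite !mulrBl.
Qed.

Lemma cut_formBr (V : finType) (U : V -> V -> R) f g g' :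
  cut_form U f (fun x => g x - g' x) = cut_form U f g - cut_form U f g'.
Proof.
rewrite /cut_form -sumrB; apply: eq_bigr => x _.
by rewrite -sumrB; apply: eq_bigr => y _ /=; rewrite mulrBr mulrBl.
Qed.

Lemma cut_form_extl (V : finType) (U : V -> V -> R) f f' g g' :
  f =1 f' -> g =1 g' -> cut_form U f g = cut_form U f' g'.
Proof.
by move=> ef eg; apply: eq_bigr => x _; apply: eq_bigr => y _; rewrite ef eg.
Qed.

(* A function [f] with values in [-1, 1] is [F - (1 - F)] for [F := (1 + f) / 2]. *)
Lemma cut_le_signed (V : finType) (U : V -> V -> R) (M : R) (f g : V -> R) :
  cut_le U M -> (forall x, `|f x| <= 1) -> (forall x, `|g x| <= 1) ->
  `|cut_form U f g| <= 4 * M.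
Proof.
move=> UM f1 g1.
pose F (f : V -> R) x := (1 + f x) / 2; pose F' (f : V -> R) x := 1 - F f x.
have unitF h : (forall x, `|h x| <= 1) -> unit_fun (F h).
  by move=> h1 x; have := h1 x; rewrite ler_norml /F => /andP[? ?]; apply/andP; split; lra.
have unitF' h : (forall x, `|h x| <= 1) -> unit_fun (F' h).
  move=> h1 x; have := unitF h h1 x; rewrite /F'.
  by move: (F h x) => u /andP[? ?]; apply/andP; split; lra.
have FE h : h =1 (fun x => F h x - F' h x) by move=> x /=; rewrite /F' /F; lra.
have -> : cut_form U f g = cut_form U (F f) (F g) - cut_form U (F f) (F' g)
    - (cut_form U (F' f) (F g) - cut_form U (F' f) (F' g)).
  by rewrite (cut_form_extl U (FE f) (FE g)) cut_formBl !cut_formBr.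
move: (UM _ _ (unitF _ f1) (unitF _ g1)) (UM _ _ (unitF' _ f1) (unitF _ g1)).
move: (UM _ _ (unitF _ f1) (unitF' _ g1)) (UM _ _ (unitF' _ f1) (unitF' _ g1)).
move: (cut_form _ _ _) (cut_form _ _ _) (cut_form _ _ _) (cut_form _ _ _).
move=> a b c d.
rewrite !ler_norml => /andP[? ?] /andP[? ?] /andP[? ?] /andP[? ?].
by apply/andP; split; lra.
Qed.

Lemma cut_form_pull (V Y : finType) (th : Y -> V) (U : V -> V -> R) f g :
  cut_form (fun y y' => U (th y) (th y')) f g =
  cut_form U (fun x => \sum_(y | th y == x) f y)
             (fun x => \sum_(y | th y == x) g y).
Proof.
rewrite /cut_form (partition_big th predT) //=; apply: eq_bigr => x _.
under [RHS]eq_bigr => y _ do rewrite -mulrA mulr_suml.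
rewrite [RHS]exchange_big /=; apply: eq_bigr => y /eqP <-.
rewrite (partition_big th predT) //=; apply: eq_bigr => x' _.
rewrite mulr_suml mulr_sumr; apply: eq_bigr => y' /eqP <-.
by rewrite mulrA.
Qed.

Lemma cut_formZ (V : finType) (U : V -> V -> R) a b f g :
  cut_form U (fun x => a * f x) (fun x => b * g x) = a * b * cut_form U f g.
Proof.
rewrite /cut_form mulr_sumr; apply: eq_bigr => x _.
by rewrite mulr_sumr; apply: eq_bigr => y _; ring.
Qed.

(** Summing a test function over the fibres of [th] and dividing by [s] gives a [0,1]-valued
    function again. This happens in both variables, whence [s ^+ 2]. *)
Lemma cut_le_pull (V Y : finType) (th : Y -> V) (U : V -> V -> R) (s M : R) :
  0 < s -> (forall x, #|[pred y | th y == x]|%:R <= s) -> cut_le U M ->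
  cut_le (fun y y' => U (th y) (th y')) (s ^+ 2 * M).
Proof.
move=> s0 ths UM f g f01 g01; rewrite cut_form_pull.
pose F (f : Y -> R) x := s^-1 * \sum_(y | th y == x) f y.
have FE h : (fun x => \sum_(y | th y == x) h y) =1 (fun x => s * F h x).
  by move=> x; rewrite /F mulVKf // gt_eqF.
have unitF h : unit_fun h -> unit_fun (F h).
  move=> h01 x; apply/andP; split.
    by rewrite mulr_ge0 ?invr_ge0 ?(ltW s0) // sumr_ge0 // => y _; case/andP: (h01 y).
  rewrite /F ler_pdivrMl // mulr1; apply: le_trans (ths x).
  rewrite -sum1_card natr_sum; apply: ler_sum => y _; by case/andP: (h01 y).
rewrite (cut_form_extl U (FE f) (FE g)) cut_formZ normrM -expr2.
rewrite ger0_norm ?sqr_ge0 // ler_pM2l ?exprn_gt0 //.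
by apply: UM; apply: unitF.
Qed.

Section Labels.
Context (V L : finType) (lab : V -> L).

Definition class_card (l : L) : nat := #|[pred x | lab x == l]|.

(* Equal to 0 when a class is empty. *)
Definition class_avg (U : V -> V -> R) (l l' : L) : R :=
  (\sum_(x | lab x == l) \sum_(y | lab y == l') U x y) /
  ((class_card l)%:R * (class_card l')%:R).

Lemma class_card_gt0 x : (0 < class_card (lab x))%N.
Proof. by apply/card_gt0P; exists x; rewrite inE. Qed.

Lemma sum_class_card : (\sum_l class_card l = #|V|)%N.
Proof.
rewrite -sum1_card (partition_big lab predT) //=.
by apply: eq_bigr => l _; rewrite sum1_card.
Qed.

Lemma cut_form_labelled (U : V -> V -> R) (a b : L -> R) :
  cut_form U (a \o lab) (b \o lab) = \sum_l \sum_l'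
    a l * b l' * (\sum_(x | lab x == l) \sum_(y | lab y == l') U x y).
Proof.
rewrite /cut_form (partition_big lab predT) //=; apply: eq_bigr => l _.
under [RHS]eq_bigr => l' _ do rewrite mulr_sumr.
rewrite [RHS]exchange_big /=; apply: eq_bigr => x /eqP <-.
rewrite (partition_big lab predT) //=; apply: eq_bigr => l' _.
by rewrite mulr_sumr; apply: eq_bigr => y /eqP <-.
Qed.

(** Testing the averaged kernel with [f] and [g] amounts to testing [U] with their class averages,
    which are again [0,1]-valued. *)
Lemma cut_le_avg (U : V -> V -> R) (M : R) :
  cut_le U M -> cut_le (fun x y => class_avg U (lab x) (lab y)) M.
Proof.
move=> UM f g f01 g01; rewrite cut_form_pull.
pose F (f : V -> R) l := (\sum_(y | lab y == l) f y) / (class_card l)%:R.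
have unitF h : unit_fun h -> unit_fun (F h \o lab).
  move=> h01 x; have c0 : 0 < (class_card (lab x))%:R :> R by rewrite ltr0n class_card_gt0.
  rewrite /F /=; apply/andP; split.
    by rewrite divr_ge0 ?(ltW c0) // sumr_ge0 // => y _; case/andP: (h01 y).
  rewrite ler_pdivrMr // mul1r /class_card -sum1_card natr_sum.
  by apply: ler_sum => y _; case/andP: (h01 y).
have := UM _ _ (unitF _ f01) (unitF _ g01).
rewrite cut_form_labelled /cut_form; congr (`|_| <= _).
apply: eq_bigr => l _; apply: eq_bigr => l' _.
by rewrite /F /class_avg invfM; ring.
Qed.

(** A step function equals its own class averages. Taking the labels of actual nodes ensures that
    the two classes are nonempty. *)
Lemma class_avg_sub (W : V -> V -> R) (D : L -> L -> R) x y :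
  class_avg (fun x y => W x y - D (lab x) (lab y)) (lab x) (lab y) =
  class_avg W (lab x) (lab y) - D (lab x) (lab y).
Proof.
have c0 z : (class_card (lab z))%:R != 0 :> R.
  by rewrite pnatr_eq0 -lt0n class_card_gt0.
have cc0 := mulf_neq0 (c0 x) (c0 y).
apply: (mulIf cc0); rewrite mulrBl !divfK //.
under eq_bigr => z /eqP zx.
  under eq_bigr => t /eqP tx do rewrite zx tx.
  rewrite sumrB sumr_const -[X in _ - X]mulr_natr; over.
rewrite sumrB sumr_const -[X in _ - X]mulr_natr; congr (_ - _).
by rewrite -mulrA; congr (_ * _); rewrite mulrC.
Qed.

(* Replacing the values of a step function by the averages of [W] at most
   doubles the distance, because averaging contracts the cut norm. *)
Lemma cut_le_class_avg (W : V -> V -> R) (D : L -> L -> R) (M : R) :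
  cut_le (fun x y => W x y - D (lab x) (lab y)) M ->
  cut_le (fun x y => W x y - class_avg W (lab x) (lab y)) (2 * M).
Proof.
move=> WD; have /cut_leN WA := cut_le_avg WD.
have -> : 2 * M = M + M by ring.
apply: cut_le_ext (cut_leD WD WA) => x y /=.
by rewrite class_avg_sub; ring.
Qed.

Lemma class_avg_bound (W : V -> V -> R) :
  (forall x y, `|W x y| <= 1) -> forall l l', `|class_avg W l l'| <= 1.
Proof.
move=> W1 l l'; rewrite /class_avg.
have [->|nz] := eqVneq ((class_card l)%:R * (class_card l')%:R : R) 0.
  by rewrite invr0 mulr0 normr0.
have pos : 0 < (class_card l)%:R * (class_card l')%:R :> R.
  by rewrite lt_neqAle eq_sym nz mulr_ge0.
rewrite normf_div (gtr0_norm pos) ler_pdivrMr // mul1r.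
rewrite (le_trans (ler_norm_sum _ _ _)) //.
have -> : (class_card l)%:R * (class_card l')%:R =
    \sum_(x | lab x == l) (class_card l')%:R :> R.
  by rewrite sumr_const mulr_natl.
apply: ler_sum => x _; rewrite (le_trans (ler_norm_sum _ _ _)) //.
by rewrite /class_card -sum1_card natr_sum; apply: ler_sum => y _; apply: W1.
Qed.

End Labels.

(** A pair contributes only if the labels differ at one of its nodes; there are at most 2 r |Y| such
    pairs, each contributing at most 2 K. *)
Lemma cut_le_mismatch (Y L : finType) (h : L -> L -> R) (a b : Y -> L) (K r : R) :
  (forall l l', `|h l l'| <= K) -> #|[pred y | a y != b y]|%:R <= r ->
  cut_le (fun x y => h (a x) (a y) - h (b x) (b y)) (4 * K * r * #|Y|%:R).
Proof.
move=> h1 ab; apply: cut_le_sum.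
have [Y0|Y0] := eqVneq #|Y| 0%N.
  by rewrite Y0 mulr0 big1 // => x; have := card0_eq Y0 x.
have /card_gt0P[y0 _] : (0 < #|Y|)%N by rewrite lt0n.
have K0 : 0 <= K by apply: le_trans (h1 (a y0) (a y0)).
pose m y : R := (a y != b y)%:R.
have -> : 4 * K * r * #|Y|%:R = 2 * K * (r * #|Y|%:R) + 2 * K * (#|Y|%:R * r) by ring.
have m_r : \sum_y m y <= r.
  by apply: le_trans ab; rewrite -sum1_card natr_sum [leRHS]big_mkcond; apply: ler_sum => y _;
    rewrite /m inE; case: (a y != b y).
have leh x y : `|h (a x) (a y) - h (b x) (b y)| <= 2 * K * m x + 2 * K * m y.
  rewrite /m; case: eqP => [->|_]; last first.
    rewrite (le_trans (ler_normB _ _)) //.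
    have := h1 (a x) (a y); have := h1 (b x) (b y).
    by case: (a y != b y) => /= ? ?; lra.
  case: eqP => [->|_]; first by rewrite subrr normr0 !mulr0 addr0.
  rewrite (le_trans (ler_normB _ _)) //=.
  by have := h1 (b x) (a y); have := h1 (b x) (b y) => ? ?; lra.
apply: (@le_trans _ _ (\sum_x \sum_y (2 * K * m x + 2 * K * m y))).
  by apply: ler_sum => x _; apply: ler_sum => y _; apply: leh.
under eq_bigr do rewrite big_split sumr_const /= -mulr_sumr -[X in X + _]mulr_natr.
rewrite big_split sumr_const /= -mulr_suml -mulr_sumr -[X in _ + X]mulr_natr.
rewrite -[X in X + _]mulrA -[X in _ + X]mulrA [_ * #|_|%:R in X in _ + X]mulrC.
by rewrite lerD // ler_wpM2l ?mulr_ge0 // ?ler_wpM2l ?ler_wpM2r.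
Qed.

End CutNorm.

(** * Four-cycle sums *)

Section FourCycles.
Context {R : realFieldType}.

Lemma sqr_sum_le (I : finType) (a : I -> R) :
  (\sum_i a i) ^+ 2 <= #|I|%:R * \sum_i a i ^+ 2.
Proof.
have : 0 <= \sum_i \sum_j (a i - a j) ^+ 2.
  by apply: sumr_ge0 => i _; apply: sumr_ge0 => j _; apply: sqr_ge0.
have -> : \sum_i \sum_j (a i - a j) ^+ 2 =
    2 * (#|I|%:R * \sum_i a i ^+ 2) - 2 * (\sum_i a i) ^+ 2.
  have -> : 2 * (#|I|%:R * \sum_i a i ^+ 2) =
      \sum_i \sum_(j : I) a i ^+ 2 + \sum_(i : I) \sum_j a j ^+ 2.
    have E : \sum_i \sum_(j : I) a i ^+ 2 = #|I|%:R * \sum_i a i ^+ 2.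
      by rewrite mulr_sumr; apply: eq_bigr => i _; rewrite sumr_const mulr_natl.
    by rewrite [X in _ = _ + X]exchange_big /= E; ring.
  rewrite [X in _ - 2 * X]expr2 mulr_suml mulr_sumr -big_split -sumrB /=.
  apply: eq_bigr => i _; rewrite !mulr_sumr -big_split -sumrB /=.
  by apply: eq_bigr => j _; ring.
by rewrite subr_ge0 ler_pM2l.
Qed.

Lemma sqr_sum2_le (I : finType) (a : I -> I -> R) :
  (\sum_i \sum_j a i j) ^+ 2 <= #|I|%:R ^+ 2 * \sum_i \sum_j a i j ^+ 2.
Proof.
rewrite !pair_bigA /= (le_trans (sqr_sum_le _)) //.
by rewrite card_prod natrM expr2.
Qed.

(** Closed walks x y x' y', degenerate ones included: the fourth power of the unnormalised box norm,
    in a form that shows it to be nonnegative. *)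
Definition C4 (V : finType) (U : V -> V -> R) : R :=
  \sum_y \sum_y' (\sum_x U x y * U x y') ^+ 2.

Lemma C4E (V : finType) (U : V -> V -> R) : C4 U =
  \sum_x' \sum_y' \sum_x \sum_y U x y * U x y' * U x' y * U x' y'.
Proof.
rewrite /C4 exchange_big /= [RHS]exchange_big; apply: eq_bigr => y' _ /=.
under eq_bigr => y _ do rewrite expr2 big_distrlr /=.
rewrite exchange_big [RHS]exchange_big /=; apply: eq_bigr => x _.
rewrite exchange_big /=; apply: eq_bigr => x' _.
by apply: eq_bigr => y _; rewrite !mulrA.
Qed.

Lemma C4_ge0 (V : finType) (U : V -> V -> R) : 0 <= C4 U.
Proof. by do 2 (apply: sumr_ge0 => ? _); apply: sqr_ge0. Qed.

(** Cauchy-Schwarz over [x] removes [f], and Cauchy-Schwarz over the pairs (y, y') removes [g];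
    together they bound the fourth power of the cut form by |V|^4 times [C4 U]. *)
Lemma cut_le_C4 (V : finType) (U : V -> V -> R) (r : R) :
  0 <= r -> C4 U <= (r * #|V|%:R) ^+ 4 -> cut_le U (r * #|V|%:R ^+ 2).
Proof.
move=> r0 UC f g f01 g01; set k : R := #|V|%:R in UC *.
have k0 : 0 <= k by rewrite ler0n.
have sq1 (h : V -> R) x : unit_fun h -> 0 <= h x ^+ 2 <= 1.
  by move=> /(_ x) /andP[h0 h1]; rewrite sqr_ge0 exprn_ile1.
have step1 : cut_form U f g ^+ 2 <=
    k * \sum_y \sum_y' g y * g y' * \sum_x U x y * U x y'.
  have -> : cut_form U f g = \sum_x f x * \sum_y g y * U x y.
    by apply: eq_bigr => x _; rewrite mulr_sumr; apply: eq_bigr => y _; rewrite mulrA.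
  apply: le_trans (sqr_sum_le _) _; rewrite ler_wpM2l //.
  apply: (@le_trans _ _ (\sum_x (\sum_y g y * U x y) ^+ 2)).
    apply: ler_sum => x _; rewrite exprMn ler_piMl ?sqr_ge0 //.
    by case/andP: (sq1 f x f01).
  under eq_bigr => x _.
    rewrite expr2 big_distrlr /=; over.
  rewrite exchange_big /=; apply: ler_sum => y _.
  rewrite exchange_big /=; apply: ler_sum => y' _.
  by rewrite mulr_sumr; apply: ler_sum => x _; rewrite mulrACA.
have step2 : (\sum_y \sum_y' g y * g y' * \sum_x U x y * U x y') ^+ 2 <=
    k ^+ 2 * C4 U.
  apply: le_trans (sqr_sum2_le _) _; rewrite ler_wpM2l ?exprn_ge0 //.
  apply: ler_sum => y _; apply: ler_sum => y' _.
  rewrite exprMn ler_piMl ?sqr_ge0 // exprMn.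
  by case/andP: (sq1 g y g01) => ? ?; case/andP: (sq1 g y' g01) => ? ?; rewrite mulr_ile1.
have k2 : 0 <= r * k ^+ 2 by rewrite mulr_ge0 ?exprn_ge0.
rewrite -(@ler_pXn2r _ 4) ?nnegrE //.
rewrite (_ : `|_| ^+ 4 = (cut_form U f g ^+ 2) ^+ 2); last first.
  by rewrite -exprM -normrX ger0_norm // (@exprM _ _ 2 2) sqr_ge0.
apply: (@le_trans _ _ ((k * \sum_y \sum_y' g y * g y' * \sum_x U x y * U x y') ^+ 2)).
  by rewrite ler_pXn2r ?nnegrE ?sqr_ge0 ?(le_trans (sqr_ge0 _) step1).
rewrite exprMn (_ : (r * k ^+ 2) ^+ 4 = k ^+ 2 * (k ^+ 2 * (r * k) ^+ 4)); last by ring.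
rewrite ler_wpM2l ?exprn_ge0 // (le_trans step2) // ler_wpM2l ?exprn_ge0 //.
Qed.

(** For fixed x' and y' the sum over x and y is 4 U(x', y') times a cut form with test functions
    U(., y') / 2 and U(x', .) / 2. These take values in [-1, 1], so each of the |V|^2 pairs
    contributes at most 4 * 2 * 4 M. *)
Lemma C4_le (V : finType) (U : V -> V -> R) (M : R) :
  (forall x y, `|U x y| <= 2) -> cut_le U M -> C4 U <= 32 * #|V|%:R ^+ 2 * M.
Proof.
move=> U2 UM; rewrite C4E.
have -> : 32 * #|V|%:R ^+ 2 * M = \sum_(x' : V) \sum_(y' : V) 32 * M.
  by rewrite !sumr_const -!mulrnA -[RHS]mulr_natr natrM; ring.
apply: ler_sum => x' _; apply: ler_sum => y' _.
have -> : \sum_x \sum_y U x y * U x y' * U x' y * U x' y' =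
    4 * U x' y' * cut_form U (fun x => U x y' / 2) (fun y => U x' y / 2).
  rewrite /cut_form mulr_sumr; apply: eq_bigr => x _.
  by rewrite mulr_sumr; apply: eq_bigr => y _; field.
have half x y : `|U x y / 2| <= 1.
  by rewrite normf_div (ger0_norm (_ : 0 <= 2)) // ler_pdivrMr // mul1r.
apply: le_trans (ler_norm _) _; rewrite !normrM (ger0_norm (_ : 0 <= 4)) //.
have -> : 32 * M = (4 * 2) * (4 * M) by ring.
apply: ler_pM; rewrite ?mulr_ge0 //; first by rewrite ler_pM2l.
by apply: cut_le_signed.
Qed.

End FourCycles.

(** * Weak regularity *)

Section WeakRegularity.
Context {R : realFieldType} (V : finType) (W : V -> V -> R) (eps : R).
Hypotheses (W1 : forall x y, `|W x y| <= 1) (eps0 : 0 < eps).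
Notation n := (#|V|%:R : R).

(** [c] is the average of [U] over S x T. If a is the sum of [U] there, subtracting [c] lowers the
    energy by a^2 / (|S| |T|). The new energy is nonnegative, so this drop is at most n^2; with |a|
    > eps n^2 that bounds [c]. *)
Lemma energy_decrement (U : V -> V -> R) (S T : {set V}) :
  \sum_x \sum_y U x y ^+ 2 <= n ^+ 2 ->
  eps * n ^+ 2 < `|\sum_(x in S) \sum_(y in T) U x y| ->
  exists c : R, `|c| <= eps^-1 /\
    \sum_x \sum_y (U x y - c * ((x \in S) && (y \in T))%:R) ^+ 2 <=
    \sum_x \sum_y U x y ^+ 2 - eps ^+ 2 * n ^+ 2.
Proof.
move=> Un; rewrite -cut_form_indicator; set a := cut_form _ _ _ => ha.
pose N : R := #|S|%:R * #|T|%:R.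
have Nn : N <= n ^+ 2.
  by rewrite /N expr2 ler_pM // ler_nat max_card.
have N0 : 0 < N.
  rewrite /N -natrM ltr0n lt0n; apply: contraTN ha => N0.
  suff -> : a = 0 by rewrite normr0 -leNgt mulr_ge0 ?(ltW eps0) ?exprn_ge0.
  move: N0; rewrite /a cut_form_indicator muln_eq0 !cards_eq0.
  case/orP => /eqP ->; first by rewrite big_set0.
  by rewrite big1 // => x _; rewrite big_set0.
have E : \sum_x \sum_y (U x y - a / N * ((x \in S) && (y \in T))%:R) ^+ 2 =
    \sum_x \sum_y U x y ^+ 2 - 2 * (a / N) * a + (a / N) ^+ 2 * N.
  have NE : N = \sum_x \sum_y ((x \in S) && (y \in T))%:R.
    rewrite /N -!sum1_card !natr_sum mulr_suml big_mkcond; apply: eq_bigr => x _.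
    case: (x \in S); last by rewrite big1.
    by rewrite mul1r big_mkcond; apply: eq_bigr => y _; case: (y \in T).
  move: (a / N) => c; rewrite NE /a /cut_form !mulr_sumr -sumrB -big_split.
  apply: eq_bigr => x _; rewrite !mulr_sumr -sumrB -big_split; apply: eq_bigr => y _ /=.
  by case: (x \in S); case: (y \in T) => /=; ring.
have E' : \sum_x \sum_y U x y ^+ 2 - 2 * (a / N) * a + (a / N) ^+ 2 * N =
  \sum_x \sum_y U x y ^+ 2 - a ^+ 2 / N by field; rewrite gt_eqF.
have {}E := etrans E E'; exists (a / N); split.
  have aN : `|a| ^+ 2 <= N * n ^+ 2.
    rewrite real_normK ?num_real // mulrC -ler_pdivrMr //; apply: le_trans Un.
    rewrite -subr_ge0 -E; do 2 (apply: sumr_ge0 => ? _); exact: sqr_ge0.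
  have a0 : 0 < `|a| by apply: le_lt_trans ha; rewrite mulr_ge0 ?exprn_ge0 // ltW.
  rewrite normf_div (gtr0_norm N0) ler_pdivrMr // ler_pdivlMl //.
  rewrite -(ler_pM2r a0) -mulrA -expr2.
  apply: (@le_trans _ _ (eps * (N * n ^+ 2))); first by rewrite ler_pM2l.
  by rewrite mulrCA ler_pM2l // ltW.
rewrite E lerB // ler_pdivlMr //.
apply: (@le_trans _ _ ((eps * n ^+ 2) ^+ 2)).
  rewrite exprMn -mulrA ler_wpM2l ?sqr_ge0 // [leRHS]expr2 ler_wpM2l ?exprn_ge0 //.
rewrite -(real_normK (num_real a)) ler_pXn2r ?nnegrE ?(ltW ha) //.
by rewrite mulr_ge0 ?exprn_ge0 ?(ltW eps0).
Qed.

(** A step splits every class into four by membership in [S] and in [T]. Once the step function is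
    good, constant bits are appended instead, so that there are 4^s labels in either case. *)
Lemma energy_iteration (s : nat) :
  exists (L : finType) (lab : V -> L) (D : L -> L -> R),
    [/\ #|L| = (4 ^ s)%N, forall l l', `|D l l'| <= s%:R / eps &
    cut_le (fun x y => W x y - D (lab x) (lab y)) (eps * n ^+ 2) \/
     \sum_x \sum_y (W x y - D (lab x) (lab y)) ^+ 2 <=
       (1 - s%:R * eps ^+ 2) * n ^+ 2].
Proof.
elim: s => [|s [L [lab [D [cardL D1 IH]]]]].
  exists unit, (fun=> tt), (fun _ _ => 0); rewrite card_unit.
  split=> //; first by rewrite normr0 mul0r.
  right.
  rewrite mul0r subr0 mul1r expr2 -sum1_card natr_sum mulr_suml.
  apply: ler_sum => x _; rewrite mul1r; apply: ler_sum => y _.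
  by rewrite subr0 -[_ ^+ 2]ger0_norm ?sqr_ge0 // normrX exprn_ile1.
have cardL' : #|{: L * (bool * bool)}| = (4 ^ s.+1)%N.
  by rewrite !card_prod card_bool cardL expnS mulnC.
case: (boolP [forall S : {set V}, forall T : {set V},
   `|\sum_(x in S) \sum_(y in T) (W x y - D (lab x) (lab y))| <= eps * n ^+ 2]).
  move=> /forallP US; exists _, (fun x => (lab x, (false, false))), (fun l l' => D l.1 l'.1).
  split=> //; last by left=> /=; apply: cut_le_set => S T; move/forallP: (US S); apply.
  by move=> l l'; rewrite (le_trans (D1 _ _)) // ler_wpM2r ?invr_ge0 ?(ltW eps0) // ler_nat.
rewrite negb_forall => /existsP[S]; rewrite negb_forall => /existsP[T].
rewrite -ltNge => hST; case: IH => [/(cut_leP S T)|IH]; first by rewrite leNgt hST.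
have [|c [c1 hc]] := energy_decrement _ hST.
  apply: le_trans IH _; rewrite ler_piMl ?exprn_ge0 // lerBlDr lerDl.
  by rewrite mulr_ge0 ?exprn_ge0 // ltW.
exists _, (fun x => (lab x, (x \in S, x \in T))),
  (fun l l' => D l.1 l'.1 + c * (l.2.1 && l'.2.2)%:R); split=> //.
  move=> l l'; apply: le_trans (ler_normD _ _) _; rewrite -natr1 mulrDl mul1r lerD //.
  by rewrite normrM; case: (_ && _); rewrite ?normr1 ?mulr1 // normr0 mulr0 invr_ge0 ltW.
right=> /=.
under eq_bigr => x _ do under eq_bigr => y _ do rewrite opprD addrA.
apply: le_trans hc _.
rewrite (_ : (1 - s.+1%:R * eps ^+ 2) * n ^+ 2 =
  (1 - s%:R * eps ^+ 2) * n ^+ 2 - eps ^+ 2 * n ^+ 2) ?lerB //.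
by rewrite -natr1; ring.
Qed.

(** If the cut bound has not been reached, the energy after [t] steps is at most eps^2 n^2, and
    Cauchy-Schwarz turns this into the cut bound. Stopping here rather than at an impossible energy
    saves one step. The bound on [D] is what later makes relabelling a few nodes cheap. *)
Lemma weak_regularity (t : nat) : 1 <= t.+1%:R * eps ^+ 2 ->
  exists (lab : V -> 'I_(4 ^ t)) (D : 'I_(4 ^ t) -> 'I_(4 ^ t) -> R),
    (forall l l', `|D l l'| <= t%:R / eps) /\
    cut_le (fun x y => W x y - D (lab x) (lab y)) (eps * n ^+ 2).
Proof.
move=> ht; have [L [lab [D [cardL D1 IH]]]] := energy_iteration t.
have {}IH : cut_le (fun x y => W x y - D (lab x) (lab y)) (eps * n ^+ 2).
  case: IH => // IH f g f01 g01.
  have e0 : 0 <= eps * n ^+ 2 by rewrite mulr_ge0 ?exprn_ge0 ?(ltW eps0).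
  rewrite -(@ler_pXn2r _ 2) ?nnegrE // -normrX ger0_norm ?sqr_ge0 //.
  rewrite (le_trans (sqr_sum2_le _)) //.
  rewrite (_ : (_ * _) ^+ 2 = n ^+ 2 * (eps ^+ 2 * n ^+ 2)); last by ring.
  rewrite ler_wpM2l ?exprn_ge0 //.
  apply: le_trans (le_trans IH _); last first.
    by rewrite ler_wpM2r ?exprn_ge0 //; move: ht; rewrite -natr1; lra.
  apply: ler_sum => x _; apply: ler_sum => y _; rewrite exprMn ler_piMl ?sqr_ge0 //.
  have /andP[f0 f1] := f01 x; have /andP[g0 g1] := g01 y.
  by rewrite exprn_ile1 ?mulr_ge0 // mulr_ile1.
pose e : L -> 'I_(4 ^ t) := fun l => cast_ord cardL (enum_rank l).
pose e' i := enum_val (cast_ord (esym cardL) i).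
have eK : cancel e e' by move=> l; rewrite /e' /e cast_ordK enum_rankK.
exists (e \o lab), (fun i j => D (e' i) (e' j)).
by split=> //; apply: cut_le_ext IH => x y /=; rewrite !eK.
Qed.

End WeakRegularity.

(** * Label-preserving injections *)

Section Matching.
Context (A B L : finType) (a : A -> L) (b : B -> L).
Local Open Scope nat_scope.

Lemma sum_class_card_in (X : {set A}) :
  \sum_l #|[set x in X | a x == l]%SET| = #|X|.
Proof.
rewrite -sum1_card (partition_big a predT) //=; apply: eq_bigr => l _.
by rewrite -sum1_card; apply: eq_bigl => x; rewrite inE.
Qed.

(** Greedy matching. Pairing two nodes with equal labels leaves the excess of every label, the
    truncated difference, unchanged. When no such pair is left, no label of [X] occurs in [Y], all
    of [X] is excess, and any injection will do. *)
Lemma set_matching (b0 : B) (X : {set A}) (Y : {set B}) : #|X| <= #|Y| ->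
  exists f : A -> B,
    [/\ {in X &, injective f}, forall x, x \in X -> f x \in Y
      & #|[set x in X | b (f x) != a x]%SET| <=
        \sum_l (#|[set x in X | a x == l]%SET| - #|[set y in Y | b y == l]%SET|)].
Proof.
have [n] := ubnP #|X|; elim: n X Y => // n IH X Y ltXn leXY.
case: (boolP [exists x in X, exists y in Y, b y == a x]).
  move=> /'exists_andP[x [xX /'exists_andP[y [yY /eqP yx]]]].
  have [|| f [finj fY fm]] := IH (X :\ x)%SET (Y :\ y)%SET.
  - by move: ltXn; rewrite (cardsD1 x X) xX.
  - by move: leXY; rewrite (cardsD1 x X) (cardsD1 y Y) xX yY.
  exists (fun z => if z == x then y else f z); split.
  - move=> z z' zX z'X; case: eqP => [->|/eqP zx]; case: eqP => [->|/eqP z'x] //.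
    + by move=> yE; have := fY z'; rewrite !inE z'x z'X -yE eqxx => /(_ isT).
    + by move=> yE; have := fY z; rewrite !inE zx zX yE eqxx => /(_ isT).
    + by apply: finj; rewrite !inE ?zx ?z'x.
  - move=> z zX; case: eqP => // /eqP zx.
    by have := fY z; rewrite !inE zx zX => /(_ isT) /andP[].
  - apply: leq_trans (leq_trans fm _).
      apply: subset_leq_card; apply/fintype.subsetP => z; rewrite !inE.
      by case: (eqVneq z x) => [->|_] //; rewrite yx eqxx andbF.
    apply: leq_sum => l _.
    have -> : #|[set z in X | a z == l]%SET| =
        (a x == l) + #|[set z in X :\ x | a z == l]%SET|.
      rewrite (cardsD1 x) inE xX; congr (_ + _); apply: eq_card => z.
      by rewrite !inE andbA.
    have -> : #|[set z in Y | b z == l]%SET| =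
        (b y == l) + #|[set z in Y :\ y | b z == l]%SET|.
      rewrite (cardsD1 y) inE yY; congr (_ + _); apply: eq_card => z.
      by rewrite !inE andbA.
    by rewrite yx subnDl.
rewrite negb_exists => /forallP noXY.
have {}noXY x y : x \in X -> y \in Y -> b y != a x.
  move=> xX yY; have := noXY x; rewrite xX negb_exists => /forallP/(_ y).
  by rewrite yY.
exists (fun z => nth b0 (enum Y) (index z (enum X))).
have lt_index z : z \in X -> index z (enum X) < size (enum Y).
  by move=> zX; rewrite -cardE (leq_trans _ leXY) // cardE index_mem mem_enum.
split.
- move=> z z' zX z'X /eqP; rewrite nth_uniq ?lt_index ?enum_uniq // => /eqP.
  by move=> E; rewrite -(nth_index z (_ : z \in enum X)) ?E ?nth_index ?mem_enum.
- by move=> z zX; rewrite -mem_enum mem_nth ?lt_index.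
apply: leq_trans (_ : #|X| <= _).
  by apply: subset_leq_card; apply/fintype.subsetP => z; rewrite inE => /andP[].
rewrite -{1}(sum_class_card_in X); apply: leq_sum => l _.
case: (set_0Vmem [set x in X | a x == l]%SET) => [->|[x]]; first by rewrite cards0.
rewrite inE => /andP[xX /eqP <-].
suff -> : [set y in Y | b y == a x]%SET = finset.set0 by rewrite cards0 subn0.
by apply/finset.setP => y; rewrite !inE; case: (boolP (y \in Y)) => //= /(noXY _ _ xX)/negPf.
Qed.

Lemma label_matching : #|A| <= #|B| -> exists f : A -> B,
  injective f /\ #|[pred x | b (f x) != a x]| <=
    \sum_l (class_card a l - class_card b l).
Proof.
move=> leAB; case: (pickP (@predT A)) => [x0 _|A0]; last first.
  have absurd (x : A) : B by have := A0 x.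
  exists absurd; split=> [x|]; first by have := A0 x.
  by rewrite eq_card0 // => x; have := A0 x.
have /card_gt0P[b0 _] : 0 < #|B| by apply: leq_trans leAB; apply/card_gt0P; exists x0.
have [|f [finj _ fm]] := @set_matching b0 [set: A]%SET [set: B]%SET; first by rewrite !cardsT.
exists f; split=> [x y|]; first by apply: finj; rewrite inE.
apply: leq_trans (leq_trans fm _).
  by apply: subset_leq_card; apply/fintype.subsetP => x; rewrite !inE.
apply: leq_sum => l _; rewrite leq_sub //; apply: subset_leq_card;
  by apply/fintype.subsetP => x; rewrite !inE.
Qed.

End Matching.

Definition class_freq {R : realFieldType} (A L : finType) (a : A -> L) (l : L) : R :=
  (class_card a l)%:R / #|A|%:R.

Lemma class_freq_ge0 {R : realFieldType} (A L : finType) (a : A -> L) (l : L) :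
  0 <= class_freq a l :> R.
Proof. by rewrite divr_ge0. Qed.

(** As #|A| <= #|B|, the class [l] of [b] has at least [class_freq b l] times #|A| elements, so a
    positive excess is at most the difference of the frequencies times #|A|. *)
Lemma label_matching_freq {R : realFieldType} (A B L : finType)
    (a : A -> L) (b : B -> L) (r : R) : (#|A| <= #|B|)%N ->
  \sum_l `|class_freq a l - class_freq b l| <= r ->
  exists f : A -> B, injective f /\ #|[pred x | b (f x) != a x]|%:R <= r * #|A|%:R.
Proof.
move=> leAB hr; have [f [finj fm]] := label_matching a b leAB.
exists f; split=> //; move: fm; rewrite -(ler_nat R) => /le_trans; apply.
apply: (@le_trans _ _ ((\sum_l `|class_freq a l - class_freq b l|) * #|A|%:R)); last first.
  by rewrite ler_wpM2r.
rewrite natr_sum mulr_suml; apply: ler_sum => l _.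
case: (leqP (class_card a l) (class_card b l)) => [/eqP ->|lt_ba].
  by rewrite mulr_ge0.
rewrite natrB; last exact: ltnW.
have A0 : 0 < #|A|%:R :> R.
  rewrite ltr0n; case: (pickP [pred x | a x == l]) => [x _|no].
    by apply/card_gt0P; exists x.
  by move: lt_ba; rewrite /class_card (eq_card0 no).
have B0 : 0 < #|B|%:R :> R by rewrite ltr0n (leq_trans _ leAB) // -(ltr0n R).
apply: (@le_trans _ _ ((class_freq a l - class_freq b l) * #|A|%:R)); last first.
  by rewrite ler_wpM2r // ler_norm.
rewrite /class_freq mulrBl divfK ?gt_eqF // lerB // -mulrA ler_piMr //.
by rewrite mulrC ler_pdivrMr // mul1r ler_nat.
Qed.

Lemma surjective_refinement (V : finType) (q : nat) (lab : V -> 'I_q) :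
  (q <= #|V|)%N -> exists (lab' : V -> 'I_q) (rho : 'I_q -> 'I_q),
    (forall i, exists x, lab' x = i) /\ forall x, lab x = rho (lab' x).
Proof.
move=> qV.
suff H d (f : V -> 'I_q) : (q <= #|codom f| + d)%N ->
    exists (lab' : V -> 'I_q) (rho : 'I_q -> 'I_q),
    (forall i, exists x, lab' x = i) /\ forall x, f x = rho (lab' x).
  by apply: (H q); apply: leq_addl.
elim: d f => [|d IH] f hd.
  exists f, id; split=> // i.
  suff /codomP[x ->] : i \in codom f by exists x.
  have : #|[predC codom f]| = 0%N.
    have := cardC [in codom f]; rewrite card_ord.
    rewrite (eq_card (_ : [in codom f] =i codom f)) //.
    rewrite (eq_card (_ : [predC [in codom f]] =i [predC codom f])) // => E.
    apply/eqP; rewrite -(eqn_add2l #|codom f|) E eqn_leq hd addn0.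
    by apply: leq_trans (eq_leq E); apply: leq_addr.
  by move/card0_eq/(_ i); rewrite !inE => /negbFE.
case: (pickP [predC codom f]) => [i /negP iNf|full]; last first.
  exists f, id; split=> // i.
  by have := full i; rewrite !inE => /negbFE/codomP[x ->]; exists x.
case: (boolP (injectiveb f)) => [/injectiveP finj|].
  have : (#|codom f| < q)%N.
    apply: leq_trans (eq_leq (card_ord q)); apply: proper_card.
    apply/properP; split; first exact/fintype.subsetP.
    by exists i => //; apply/negP.
  by rewrite (card_codom finj) ltnNge qV.
move=> /injectivePn[x [y neq_xy fxy]].
have [|lab' [rho [surj E]]] := IH (fun z => if z == x then i else f z).
  apply: leq_trans hd _; rewrite addnS -addSn leq_add2r.
  apply: (@leq_trans #|[predU1 i & codom f]|).
    by rewrite cardU1 (introT negP iNf).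
  apply: subset_leq_card; apply/fintype.subsetP => j.
  rewrite !inE => /orP[/eqP ->|/codomP[z ->]].
    by apply/codomP; exists x; rewrite eqxx.
  apply/codomP; case: (eqVneq z x) => [->|zx]; last by exists z; rewrite (negPf zx).
  by exists y; rewrite eq_sym (negPf neq_xy).
(* [f] never takes the value [i], so after the move [i] marks [x] alone and can be sent back to
   [f x]. *)
exists lab', (fun j => if rho j == i then f x else rho j); split=> // z.
rewrite -E; case: (eqVneq z x) => [->|zx]; first by rewrite eqxx.
case: eqP => // fzi; case: iNf; rewrite -fzi; exact: codom_f.
Qed.

(** * Random sign samples *)

Section Resampling.
Context {R : realFieldType} (J V : finType).

Definition ffun_upd (phi : {ffun J -> V}) (i : J) (x : V) : {ffun J -> V} :=
  [ffun j => if j == i then x else phi j].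

(** Redrawing one coordinate preserves the uniform law: exchanging [phi i] with [x] is an involution
    on the pairs (phi, x). *)
Lemma sum_resample (i : J) (F : {ffun J -> V} -> R) :
  #|V|%:R * \sum_phi F phi = \sum_phi \sum_x F (ffun_upd phi i x).
Proof.
pose g (p : {ffun J -> V} * V) := (ffun_upd p.1 i p.2, p.1 i).
have gK : involutive g.
  move=> [phi x]; rewrite /g /=; congr (_, _); last by rewrite ffunE eqxx.
  by apply/ffunP => j; rewrite !ffunE; case: eqP => // ->.
rewrite pair_bigA /= [RHS](reindex_inj (inv_inj gK)) /=.
rewrite [RHS](eq_bigr (fun p => F p.1)); last first.
  move=> p _; congr F.
  by apply/ffunP => j; rewrite !ffunE; case: eqP => // ->.
rewrite -(pair_bigA _ (fun phi _ => F phi)) /= mulr_sumr.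
by apply: eq_bigr => phi _; rewrite sumr_const mulr_natl.
Qed.

Lemma sum_marginal2 (i j : J) (F : V -> V -> R) : i != j ->
  #|V|%:R ^+ 2 * \sum_(phi : {ffun J -> V}) F (phi i) (phi j) =
  #|{ffun J -> V}|%:R * \sum_x \sum_y F x y.
Proof.
move=> ij; rewrite expr2 -mulrA (sum_resample j) (sum_resample i).
rewrite mulr_natl -sumr_const; apply: eq_bigr => phi _.
apply: eq_bigr => x _; apply: eq_bigr => y _.
by rewrite !ffunE !eqxx (negPf ij).
Qed.

Lemma sum_marginal4 (i j k l : J) (F : V -> V -> V -> V -> R) : uniq [:: i; j; k; l] ->
  #|V|%:R ^+ 4 * \sum_(phi : {ffun J -> V}) F (phi i) (phi j) (phi k) (phi l) =
  #|{ffun J -> V}|%:R * \sum_x \sum_y \sum_z \sum_t F x y z t.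
Proof.
rewrite /= !inE !negb_or !andbT => /and3P[/and3P[ij ik il] /andP[jk jl] kl].
rewrite !exprS expr0 mulr1 -!mulrA (sum_resample l) (sum_resample k).
rewrite (sum_resample j) (sum_resample i) mulr_natl -sumr_const.
apply: eq_bigr => phi _; apply: eq_bigr => x _; apply: eq_bigr => y _.
apply: eq_bigr => z _; apply: eq_bigr => t _.
by rewrite !ffunE !eqxx (negPf ij) (negPf ik) (negPf il) (negPf jk) (negPf jl) (negPf kl).
Qed.

End Resampling.

Section RandomSigns.
Context {R : realFieldType}.

Definition sgn_of (b : bool) : R := if b then 1 else -1.

Lemma norm_sgn_of b : `|sgn_of b| = 1.
Proof. by case: b; rewrite /= ?normrN normr1. Qed.

(** Expectation of a product of shifted independent signs with means [w]. It factors because the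
    positions in [l] are distinct; a sign at any other position contributes its total probability
    1. *)
Lemma sum_prod_signs (E : finType) (w : E -> R) (l : seq (E * R)) :
  uniq (map fst l) ->
  \sum_(s : {ffun E -> bool}) (\prod_e ((1 + sgn_of (s e) * w e) / 2)) *
     (\prod_(a <- l) (sgn_of (s a.1) - a.2)) = \prod_(a <- l) (w a.1 - a.2).
Proof.
move=> ul.
have split_l (F : E * R -> R) :
    \prod_(a <- l) F a = \prod_e \prod_(a <- l | a.1 == e) F a.
  exact: partition_big.
rewrite [RHS]split_l.
transitivity (\sum_(s : {ffun E -> bool}) \prod_e
    ((1 + sgn_of (s e) * w e) / 2 * \prod_(a <- l | a.1 == e) (sgn_of (s e) - a.2))).
  apply: eq_bigr => s _; rewrite split_l -big_split; apply: eq_bigr => e _ /=.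
  by congr (_ * _); apply: eq_bigr => a /eqP <-.
rewrite -(bigA_distr_bigA (fun e b => (1 + sgn_of b * w e) / 2 *
  \prod_(a <- l | a.1 == e) (sgn_of b - a.2))).
apply: eq_bigr => e _; rewrite big_bool /sgn_of.
rewrite [RHS](eq_bigr (fun a => w e - a.2)); last by move=> a /eqP <-.
rewrite -!(big_filter _ (fun a => a.1 == e)).
have : (size [seq a <- l | a.1 == e] <= 1)%N.
  rewrite size_filter (_ : count _ _ = count_mem e (map fst l)); last by rewrite count_map.
  by rewrite count_uniq_mem // leq_b1.
case: [seq a <- l | a.1 == e] => [|a [|? ?]] //= _.
  by rewrite !big_nil; field.
by rewrite !big_seq1; field.
Qed.

End RandomSigns.

Section Samples.
Context {R : realFieldType} {k : nat} {V : finType}.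
Implicit Types (W : V -> V -> R) (phi : {ffun 'I_k -> V}).
Implicit Types (s : {ffun 'I_k * 'I_k -> bool}) (e : 'I_k * 'I_k).

(* Only the sign of the pair with [e.1 < e.2] carries an edge; the other signs
   are fair coins. *)
Definition sample_weight W phi e : R :=
  if (e.1 < e.2)%N then W (phi e.1) (phi e.2) else 0.

(** Joint law of a uniform tuple of nodes, repetitions allowed, and of signs that are independent
    given the tuple. *)
Definition sample_prob W phi s : R :=
  #|{ffun 'I_k -> V}|%:R^-1 *
  \prod_e ((1 + sgn_of (s e) * sample_weight W phi e) / 2).

Definition ordered_pair (i j : 'I_k) : 'I_k * 'I_k :=
  if (i < j)%N then (i, j) else (j, i).

Definition sign_kernel s (i j : 'I_k) : R := sgn_of (s (ordered_pair i j)).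

Lemma ordered_pair_inj i j i' j' : ordered_pair i j = ordered_pair i' j' ->
  i = i' /\ j = j' \/ i = j' /\ j = i'.
Proof.
by rewrite /ordered_pair; do 2 case: ifP => _; case=> -> ->; [left|right|right|left].
Qed.

Lemma sample_weight_ordered W phi i j : (forall x y, W x y = W y x) -> i != j ->
  sample_weight W phi (ordered_pair i j) = W (phi i) (phi j).
Proof.
move=> Wsym ij; rewrite /sample_weight /ordered_pair; case: (ltnP i j) => [/= -> //|].
by rewrite leq_eqVlt eq_sym (inj_eq val_inj) (negPf ij) /= => ->; apply: Wsym.
Qed.

Section Expectations.
Context (W : V -> V -> R).
Hypotheses (W1 : forall x y, `|W x y| <= 1) (Wsym : forall x y, W x y = W y x).
Hypotheses (V0 : (0 < #|V|)%N) (k0 : (0 < k)%N).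
Notation n := (#|V|%:R : R).
Notation N := (#|{ffun 'I_k -> V}|%:R : R).

Lemma card_ffun_gt0 : 0 < N.
Proof. by rewrite ltr0n card_ffun expn_gt0 V0. Qed.

Lemma sample_weight_le1 phi e : `|sample_weight W phi e| <= 1.
Proof. by rewrite /sample_weight; case: ifP; rewrite ?W1 ?normr0 ?ler01. Qed.

Lemma sample_prob_ge0 phi s : 0 <= sample_prob W phi s.
Proof.
rewrite mulr_ge0 ?invr_ge0 ?ler0n // prodr_ge0 // => e _.
have := sample_weight_le1 phi e; rewrite ler_norml /sgn_of => /andP[? ?].
by case: (s e); lra.
Qed.

Lemma sum_sample_prob phi : \sum_s sample_prob W phi s = N^-1.
Proof.
have /(_ [::] isT) := sum_prod_signs (sample_weight W phi).
rewrite big_nil -mulr_sumr; under eq_bigr do rewrite big_nil mulr1.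
by move=> ->; rewrite mulr1.
Qed.

Lemma sum_sample_prob1 : \sum_phi \sum_s sample_prob W phi s = 1.
Proof.
under eq_bigr do rewrite sum_sample_prob.
by rewrite sumr_const -[LHS]mulr_natr mulVf // gt_eqF // card_ffun_gt0.
Qed.

Lemma sum_not_uniq (J : finType) (l : seq J) :
  \sum_x (~~ uniq (x :: l))%:R <= #|J|%:R * (~~ uniq l)%:R + (size l)%:R :> R.
Proof.
apply: (@le_trans _ _ (\sum_(x : J) ((~~ uniq l)%:R + (x \in l)%:R))).
  apply: ler_sum => x _ /=; rewrite negb_and negbK.
  by case: (x \in l); case: (uniq l) => //=; rewrite ?addr0 ?add0r ?lerDl ?ler01.
rewrite big_split /= sumr_const mulr_natl lerD2l -natr_sum ler_nat.
by rewrite -big_mkcond sum1_card card_size.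
Qed.

Context (L : finType) (lab : V -> L) (h : L -> L -> R) (d : R).
Hypotheses (h1 : forall l l', `|h l l'| <= 1).
Notation U := (fun x y => W x y - h (lab x) (lab y)).

Definition sample_gap phi s (i j : 'I_k) : R :=
  sign_kernel s i j - h (lab (phi i)) (lab (phi j)).

Lemma sample_gap_le2 phi s i j : `|sample_gap phi s i j| <= 2.
Proof.
rewrite (le_trans (ler_normB _ _)) // norm_sgn_of.
by have := h1 (lab (phi i)) (lab (phi j)); lra.
Qed.

Definition gap_cycle phi s (i' j' i j : 'I_k) : R :=
  sample_gap phi s i j * sample_gap phi s i j' *
  sample_gap phi s i' j * sample_gap phi s i' j'.

Lemma gap_cycle_le phi s i' j' i j : gap_cycle phi s i' j' i j <= 16.
Proof.
apply: le_trans (ler_norm _) _; rewrite !normrM.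
have -> : 16 = 2 * 2 * 2 * 2 :> R by ring.
by do 3 (apply: ler_pM; rewrite ?mulr_ge0 ?sample_gap_le2 //).
Qed.

(** Four distinct indices give four distinct edges, so given [phi] the signs are independent and the
    expectation is the product of the values of [U]. The four nodes themselves are independent and
    uniform. *)
Lemma expect_gap_cycle i' j' i j : uniq [:: i'; j'; i; j] ->
  \sum_phi \sum_s sample_prob W phi s * gap_cycle phi s i' j' i j =
  n ^- 4 * C4 U.
Proof.
move=> uv; have := uv; rewrite /= !inE !negb_or !andbT.
move=> /and3P[/and3P[i'j' i'i i'j] /andP[j'i j'j] ij].
pose F x' y' x y : R := U x y * U x y' * U x' y * U x' y'.
rewrite C4E -/(F _ _ _ _).
have -> : \sum_phi \sum_s sample_prob W phi s * gap_cycle phi s i' j' i j =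
    N^-1 * \sum_(phi : {ffun 'I_k -> V}) F (phi i') (phi j') (phi i) (phi j).
  rewrite mulr_sumr; apply: eq_bigr => phi _.
  pose D i j := h (lab (phi i)) (lab (phi j)).
  pose l := [:: (ordered_pair i j, D i j); (ordered_pair i j', D i j');
                (ordered_pair i' j, D i' j); (ordered_pair i' j', D i' j')].
  have ul : uniq (map fst l).
    rewrite /= !inE !negb_or !andbT.
    have neq (a b c e : 'I_k) : (a != c) || (b != e) -> (a != e) || (b != c) ->
        ordered_pair a b != ordered_pair c e.
      by move=> n1 n2; apply/eqP => /ordered_pair_inj[[ac be]|[ae bc]];
        [move: n1; rewrite ac be !eqxx|move: n2; rewrite ae bc !eqxx].
    have sym (a b : 'I_k) : a != b -> (a != b) * (b != a).
      by move=> ab; split=> //; rewrite eq_sym.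
    have hs := (sym _ _ i'j', sym _ _ i'i, sym _ _ i'j, sym _ _ j'i, sym _ _ j'j, sym _ _ ij).
    by rewrite !neq // ?hs ?orbT.
  have -> : F (phi i') (phi j') (phi i) (phi j) =
      \prod_(a <- l) (sample_weight W phi a.1 - a.2).
    rewrite !big_cons big_nil /= !sample_weight_ordered // ?(eq_sym i j') //.
    by rewrite mulr1 !mulrA.
  rewrite -(sum_prod_signs _ ul) mulr_sumr; apply: eq_bigr => s _.
  rewrite /sample_prob -[LHS]mulrA; congr (_ * (_ * _)).
  by rewrite !big_cons big_nil mulr1 /gap_cycle -!mulrA.
have := sum_marginal4 F uv; move/(canRL (mulKf _)) => -> //; last first.
  by rewrite expf_neq0 // pnatr_eq0 -lt0n.
by rewrite mulrCA mulKf // gt_eqF // card_ffun_gt0.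
Qed.

(** Each cycle on distinct indices contributes at most 32 d. At most (3 + 2 + 1) k^3 quadruples
    repeat an index, since a new index can hit each earlier one, and each of them contributes at
    most 16. *)
Lemma expect_C4 : 0 <= d -> cut_le U (d * n ^+ 2) ->
  \sum_phi \sum_s sample_prob W phi s * C4 (sample_gap phi s) <=
  32 * d * k%:R ^+ 4 + 96 * k%:R ^+ 3.
Proof.
move=> d0 Ud.
have -> : \sum_phi \sum_s sample_prob W phi s * C4 (sample_gap phi s) =
    \sum_i' \sum_j' \sum_i \sum_j \sum_phi \sum_s
      sample_prob W phi s * gap_cycle phi s i' j' i j.
  rewrite pair_bigA /=.
  under eq_bigr => p _ do rewrite C4E mulr_sumr.
  rewrite exchange_big; apply: eq_bigr => i' _ /=.
  under eq_bigr => p _ do rewrite mulr_sumr.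
  rewrite exchange_big; apply: eq_bigr => j' _ /=.
  under eq_bigr => p _ do rewrite mulr_sumr.
  rewrite exchange_big; apply: eq_bigr => i _ /=.
  under eq_bigr => p _ do rewrite mulr_sumr.
  by rewrite exchange_big; apply: eq_bigr => j _ /=; rewrite pair_bigA.
have n0 : n != 0 by rewrite pnatr_eq0 -lt0n.
have term i' j' i j :
    \sum_phi \sum_s sample_prob W phi s * gap_cycle phi s i' j' i j <=
    32 * d + 16 * (~~ uniq [:: j; i; j'; i'])%:R.
  rewrite -(rev_uniq [:: j; i; j'; i']) /rev [catrev _ _]/=.
  case: (boolP (uniq _)) => [uv|_].
    rewrite expect_gap_cycle // mulr0 addr0.
    have U2 x y : `|U x y| <= 2.
      rewrite (le_trans (ler_normB _ _)) //.
      by have := W1 x y; have := h1 (lab x) (lab y); lra.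
    have := C4_le U2 Ud; rewrite -(ler_pM2l (_ : 0 < n ^- 4)).
      by move/le_trans; apply; rewrite le_eqVlt; apply/orP; left; apply/eqP; field.
    by rewrite invr_gt0 exprn_gt0 // lt_neqAle eq_sym n0 ler0n.
  rewrite mulr1; apply: (@le_trans _ _ 16); last by lra.
  rewrite -[leRHS]mul1r -[X in _ <= X * _]sum_sample_prob1 mulr_suml; apply: ler_sum => phi _.
  rewrite mulr_suml; apply: ler_sum => s _.
  by rewrite ler_wpM2l ?sample_prob_ge0 ?gap_cycle_le.
apply: (@le_trans _ _ (\sum_(i' : 'I_k) \sum_(j' : 'I_k) \sum_(i : 'I_k) \sum_(j : 'I_k)
    (32 * d + 16 * (~~ uniq [:: j; i; j'; i'])%:R))).
  by do 4 (apply: ler_sum => ? _); apply: term.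
have const (c : R) : \sum_(i : 'I_k) c = k%:R * c.
  by rewrite sumr_const card_ord mulr_natl.
have step (l : seq 'I_k) (a b : R) : 0 <= b ->
    \sum_x (a + b * (~~ uniq (x :: l))%:R) <=
    k%:R * a + b * (size l)%:R + b * k%:R * (~~ uniq l)%:R.
  move=> b0; rewrite big_split /= const -mulr_sumr -addrA lerD2l -mulrA -mulrDr.
  rewrite ler_wpM2l // (le_trans (sum_not_uniq l)) // card_ord addrC lexx //.
have k_ge0 : 0 <= k%:R :> R by rewrite ler0n.
apply: (@le_trans _ _ (\sum_(i' : 'I_k) \sum_(j' : 'I_k) \sum_(i : 'I_k)
  (k%:R * (32 * d) + 16 * 3 + 16 * k%:R * (~~ uniq [:: i; j'; i'])%:R))).
  by do 3 (apply: ler_sum => ? _); apply: step.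
apply: (@le_trans _ _ (\sum_(i' : 'I_k) \sum_(j' : 'I_k)
  (k%:R * (k%:R * (32 * d) + 16 * 3) + 16 * k%:R * 2 +
     16 * k%:R * k%:R * (~~ uniq [:: j'; i'])%:R))).
  by do 2 (apply: ler_sum => ? _); apply: step; rewrite mulr_ge0.
apply: (@le_trans _ _ (\sum_(i' : 'I_k)
  (k%:R * (k%:R * (k%:R * (32 * d) + 16 * 3) + 16 * k%:R * 2) + 16 * k%:R * k%:R * 1 +
     16 * k%:R * k%:R * k%:R * (~~ uniq [:: i'])%:R))).
  by do 1 (apply: ler_sum => ? _); apply: step; rewrite !mulr_ge0.
under eq_bigr do rewrite /= mulr0 addr0.
rewrite const le_eqVlt; apply/orP; left; apply/eqP; ring.
Qed.

Lemma sum_sample_prob_const (c : {ffun 'I_k -> V} -> R) :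
  \sum_phi \sum_s sample_prob W phi s * c phi = N^-1 * \sum_phi c phi.
Proof.
rewrite mulr_sumr; apply: eq_bigr => phi _.
by rewrite -mulr_suml sum_sample_prob.
Qed.

(** Variance of the mean of [k] independent centred variables [z] with values in [-1, 1]: the
    off-diagonal terms vanish. The sum over [phi] is [N] times the expectation. *)
Lemma expect_freq_dev (l : L) :
  \sum_(phi : {ffun 'I_k -> V})
     (class_freq (fun i => lab (phi i)) l - class_freq lab l) ^+ 2 <= N / k%:R.
Proof.
set al := class_freq lab l; pose z x : R := (lab x == l)%:R - al.
have n_gt0 : 0 < n by rewrite ltr0n.
have k_gt0 : 0 < k%:R :> R by rewrite ltr0n.
have cardE (A : finType) (a : A -> L) : (class_card a l)%:R = \sum_x (a x == l)%:R :> R.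
  rewrite -natr_sum /class_card -sum1_card big_mkcond; congr (_%:R).
have z0 : \sum_x z x = 0.
  rewrite sumrB -cardE sumr_const -[X in _ - X]mulr_natr /al /class_freq divfK ?subrr //.
  by rewrite gt_eqF.
have al01 : 0 <= al <= 1.
  rewrite /al /class_freq divr_ge0 // ler_pdivrMr // mul1r ler_nat.
  exact: max_card.
have zz phi : (class_freq (fun i => lab (phi i)) l - al) ^+ 2 =
    k%:R ^- 2 * \sum_i \sum_j z (phi i) * z (phi j).
  rewrite -big_distrlr /= /z sumrB -(cardE _ (fun i => lab (phi i))) sumr_const.
  by rewrite /class_freq card_ord -[al *+ k]mulr_natr; field; rewrite gt_eqF.
under eq_bigr => phi _ do rewrite zz.
rewrite -mulr_sumr exchange_big.
under eq_bigr => i _ do rewrite exchange_big.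
apply: (@le_trans _ _ (k%:R ^- 2 * \sum_(i : 'I_k) \sum_(j : 'I_k) (if j == i then N else 0))).
  rewrite ler_wpM2l ?invr_ge0 ?exprn_ge0 ?ler0n //.
  apply: ler_sum => i _; apply: ler_sum => j _.
  case: (eqVneq j i) => [->|ji].
    rewrite -[N]mul1r -sum1_card natr_sum mulr_sumr; apply: ler_sum => phi _.
    rewrite mulr1 -expr2 -(real_normK (num_real _)) exprn_ile1 //.
    move: al01 => /andP[? ?]; rewrite /z ler_norml.
    by case: eqP => _ /=; apply/andP; split; lra.
  have := sum_marginal2 (fun x y => z x * z y) (_ : i != j); rewrite eq_sym ji => /(_ isT).
  rewrite -big_distrlr /= z0 mul0r mulr0 => /eqP.
  by rewrite mulf_eq0 expf_eq0 /= gt_eqF // => /eqP ->.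
under eq_bigr => i _ do rewrite -big_mkcond big_pred1_eq.
rewrite sumr_const card_ord -[X in _ * X]mulr_natr le_eqVlt; apply/orP; left; apply/eqP; field.
by rewrite gt_eqF.
Qed.

Definition label_dist phi : R :=
  \sum_l `|class_freq (fun i => lab (phi i)) l - class_freq lab l|.

Lemma expect_label_dist :
  \sum_phi \sum_s sample_prob W phi s * label_dist phi ^+ 2 <= #|L|%:R ^+ 2 / k%:R.
Proof.
rewrite sum_sample_prob_const ler_pdivrMl ?card_ffun_gt0 //.
apply: (@le_trans _ _ (\sum_(phi : {ffun 'I_k -> V}) #|L|%:R *
    \sum_l (class_freq (fun i => lab (phi i)) l - class_freq lab l) ^+ 2)).
  apply: ler_sum => phi _; apply: le_trans (sqr_sum_le _) _.
  by under eq_bigr do rewrite real_normK ?num_real //.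
rewrite -mulr_sumr exchange_big /=.
apply: (@le_trans _ _ (#|L|%:R * \sum_(l : L) (N / k%:R))).
  by rewrite ler_wpM2l // ler_sum // => l _; apply: expect_freq_dev.
rewrite sumr_const -[X in _ * X]mulr_natr le_eqVlt; apply/orP; left; apply/eqP; ring.
Qed.

(** Both requirements on a sample in one nonnegative number, so that a bound on a single expectation
    yields a sample meeting them together. *)
Definition sample_defect phi s : R :=
  C4 (sample_gap phi s) / k%:R ^+ 4 + label_dist phi ^+ 2.

Lemma expect_defect : 0 <= d -> cut_le U (d * n ^+ 2) ->
  \sum_phi \sum_s sample_prob W phi s * sample_defect phi s <=
  32 * d + (96 + #|L|%:R ^+ 2) / k%:R.
Proof.
move=> d0 Ud; have k_gt0 : 0 < k%:R :> R by rewrite ltr0n.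
have -> : 32 * d + (96 + #|L|%:R ^+ 2) / k%:R =
    (32 * d * k%:R ^+ 4 + 96 * k%:R ^+ 3) / k%:R ^+ 4 + #|L|%:R ^+ 2 / k%:R.
  by field; rewrite gt_eqF.
under eq_bigr => phi _.
  under eq_bigr => s _ do rewrite mulrDr mulrA.
  rewrite big_split /= -mulr_suml; over.
rewrite big_split /= -mulr_suml lerD ?expect_label_dist //.
by rewrite ler_wpM2r ?expect_C4 // invr_ge0 exprn_ge0.
Qed.

Lemma sample_defect_ge0 phi s : 0 <= sample_defect phi s.
Proof. by rewrite addr_ge0 ?sqr_ge0 // divr_ge0 ?C4_ge0 ?exprn_ge0. Qed.

Lemma sum_class_freq (A : finType) (a : A -> L) : (0 < #|A|)%N ->
  \sum_l class_freq a l = 1 :> R.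
Proof.
move=> A0; rewrite -mulr_suml -natr_sum sum_class_card divff //.
by rewrite pnatr_eq0 -lt0n.
Qed.

(** A uniform bound, used when the expectation is taken under the law of another graph: 16 from the
    cycles, 2 ^ 2 from the label frequencies. *)
Lemma sample_defect_le phi s : sample_defect phi s <= 20.
Proof.
have k_gt0 : 0 < k%:R :> R by rewrite ltr0n.
have -> : 20 = 16 + 2 ^+ 2 :> R by ring.
apply: lerD.
  rewrite ler_pdivrMr ?exprn_gt0 // C4E.
  have -> : 16 * k%:R ^+ 4 =
      \sum_(i' : 'I_k) \sum_(j' : 'I_k) \sum_(i : 'I_k) \sum_(j : 'I_k) (16 : R).
    have const (c : R) : \sum_(i : 'I_k) c = k%:R * c.
      by rewrite sumr_const card_ord mulr_natl.
    by rewrite !const; ring.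
  by do 4 (apply: ler_sum => ? _); apply: gap_cycle_le.
have ld0 : 0 <= label_dist phi by apply: sumr_ge0 => l _; apply: normr_ge0.
rewrite ler_pXn2r ?nnegrE //.
apply: (@le_trans _ _ (\sum_l (class_freq (fun i => lab (phi i)) l + class_freq lab l))).
  apply: ler_sum => l _; apply: le_trans (ler_normB _ _) _.
  by rewrite !ger0_norm ?class_freq_ge0.
by rewrite big_split /= !sum_class_freq ?card_ord //; lra.
Qed.

End Expectations.
End Samples.

(** * The law of a sample *)

Section SampleLaw.
Context {R : realFieldType} {k : nat}.

Definition sample_law (V : finType) (W : V -> V -> R) (s : {ffun 'I_k * 'I_k -> bool}) : R :=
  \sum_(phi : {ffun 'I_k -> V}) sample_prob W phi s.

Definition edge_density (V : finType) (W : V -> V -> R) (J : {set 'I_k * 'I_k}) : R :=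
  #|{ffun 'I_k -> V}|%:R^-1 *
  \sum_(phi : {ffun 'I_k -> V}) \prod_(e in J) sample_weight W phi e.

(** Expanding the product over the pairs uses each pair at most once. A set [J] of increasing pairs
    is thus a simple graph; any other [J] has density 0. *)
Lemma sample_lawE (V : finType) (W : V -> V -> R) s : sample_law W s =
  2 ^- #|{: 'I_k * 'I_k}| *
  \sum_(J : {set 'I_k * 'I_k}) (\prod_(e in J) sgn_of (s e)) * edge_density W J.
Proof.
have E phi : sample_prob W phi s = \sum_(J : {set 'I_k * 'I_k})
    2 ^- #|{: 'I_k * 'I_k}| * (\prod_(e in J) sgn_of (s e)) *
    (#|{ffun 'I_k -> V}|%:R^-1 * \prod_(e in J) sample_weight W phi e).
  rewrite /sample_prob big_split /= prodr_const exprVn.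
  under [X in _ * (X * _)]eq_bigr => e _ do rewrite addrC.
  rewrite bigA_distr mulr_suml mulr_sumr; apply: eq_bigr => J _.
  rewrite -big_mkcond big_split /=.
  move: (#|_|%:R^-1) (\prod_(e in J) _) (\prod_(e in J) _) (2 ^- _) => u v w c.
  ring.
rewrite /sample_law; under eq_bigr do rewrite E.
rewrite exchange_big mulr_sumr; apply: eq_bigr => J _ /=.
by rewrite -!mulr_sumr -mulrA.
Qed.

Lemma sample_law_close (V V' : finType) (W : V -> V -> R) (W' : V' -> V' -> R) (eta : R) s :
  (forall J : {set 'I_k * 'I_k}, `|edge_density W J - edge_density W' J| <= eta) ->
  `|sample_law W s - sample_law W' s| <= eta.
Proof.
move=> close; rewrite !sample_lawE -mulrBr -sumrB normrM.
have p2 : 0 < 2 ^- #|{: 'I_k * 'I_k}| :> R by rewrite invr_gt0 exprn_gt0.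
rewrite (gtr0_norm p2) ler_pdivrMl ?exprn_gt0 //.
apply: le_trans (ler_norm_sum _ _ _) _.
have -> : 2 ^+ #|{: 'I_k * 'I_k}| * eta = \sum_(J : {set 'I_k * 'I_k}) eta.
  rewrite sumr_const -[RHS]mulr_natl; congr (_ * _); rewrite -natrX -cardsT -card_powerset.
  by congr (_%:R); apply: eq_card => J; rewrite !inE finset.subsetT.
apply: ler_sum => J _; rewrite -mulrBr normrM normr_prod big1 ?mul1r // => e _.
exact: norm_sgn_of.
Qed.

Lemma exists_le_mean (I : finType) (p f : I -> R) (B : R) :
  (forall i, 0 <= p i) -> \sum_i p i = 1 -> \sum_i p i * f i <= B ->
  exists i, f i <= B.
Proof.
move=> p0 p1 pf; case: (boolP [exists i, f i <= B]) => [/existsP //|].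
rewrite negb_exists => /forallP no.
have gt i : 0 < f i - B by rewrite subr_gt0 ltNge no.
have pos i : 0 <= p i * (f i - B) by rewrite mulr_ge0 ?(ltW (gt i)).
have : \sum_i p i * (f i - B) <= 0.
  under eq_bigr do rewrite mulrBr.
  by rewrite sumrB -mulr_suml p1 mul1r subr_le0.
move=> le0; have /eqP : \sum_i p i * (f i - B) = 0.
  by apply/eqP; rewrite eq_le le0 sumr_ge0.
rewrite psumr_eq0 // => /allP z.
have : \sum_i p i = 0.
  apply: big1 => i _; have := z i (mem_index_enum i).
  by rewrite mulf_eq0 (gt_eqF (gt i)) orbF => /eqP.
by rewrite p1 => /eqP; rewrite oner_eq0.
Qed.

Section CommonSample.
Context (V V' L : finType) (W : V -> V -> R) (W' : V' -> V' -> R).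
Context (lab : V -> L) (lab' : V' -> L) (h h' : L -> L -> R) (d eta : R).
Hypotheses (W1 : forall x y, `|W x y| <= 1) (Wsym : forall x y, W x y = W y x).
Hypotheses (W1' : forall x y, `|W' x y| <= 1) (Wsym' : forall x y, W' x y = W' y x).
Hypotheses (V0 : (0 < #|V|)%N) (V0' : (0 < #|V'|)%N) (k0 : (0 < k)%N).
Hypotheses (h1 : forall l l', `|h l l'| <= 1) (h1' : forall l l', `|h' l l'| <= 1).
Hypotheses (d0 : 0 <= d).
Hypothesis Ud : cut_le (fun x y => W x y - h (lab x) (lab y)) (d * #|V|%:R ^+ 2).
Hypothesis Ud' : cut_le (fun x y => W' x y - h' (lab' x) (lab' y)) (d * #|V'|%:R ^+ 2).
Hypothesis close : forall J : {set 'I_k * 'I_k},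
  `|edge_density W J - edge_density W' J| <= eta.

Lemma sample_law_ge0 (V1 : finType) (W0 : V1 -> V1 -> R) s :
  (forall x y, `|W0 x y| <= 1) -> 0 <= sample_law W0 s.
Proof. by move=> W01; apply: sumr_ge0 => phi _; apply: sample_prob_ge0. Qed.

(** Minimising over the node tuples leaves functions [g] and [g'] of the signs alone, which can be
    averaged under one law. Changing the law under [g'] costs at most 20 eta for each sign
    matrix. *)
Lemma common_sample : exists s (phi : {ffun 'I_k -> V}) (phi' : {ffun 'I_k -> V'}),
  sample_defect lab h phi s + sample_defect lab' h' phi' s <=
  2 * (32 * d + (96 + #|L|%:R ^+ 2) / k%:R) +
  20 * (eta * #|{ffun 'I_k * 'I_k -> bool}|%:R).
Proof.
have /card_gt0P[x0 _] := V0; have /card_gt0P[x0' _] := V0'.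
pose m s := [arg min_(phi < [ffun => x0] : {ffun 'I_k -> V}) sample_defect lab h phi s]%O.
pose m' s := [arg min_(phi < [ffun => x0'] : {ffun 'I_k -> V'}) sample_defect lab' h' phi s]%O.
pose g s := sample_defect lab h (m s) s; pose g' s := sample_defect lab' h' (m' s) s.
have gle s phi : g s <= sample_defect lab h phi s.
  by rewrite /g /m; case: arg_minP => // i _; apply.
have gle' s phi : g' s <= sample_defect lab' h' phi s.
  by rewrite /g' /m'; case: arg_minP => // i _; apply.
have law1 : \sum_s sample_law W s = 1.
  by rewrite exchange_big sum_sample_prob1.
suff [s hs] : exists s, g s + g' s <= 2 * (32 * d + (96 + #|L|%:R ^+ 2) / k%:R) +
    20 * (eta * #|{ffun 'I_k * 'I_k -> bool}|%:R) by exists s, (m s), (m' s).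
apply: (exists_le_mean (p := sample_law W)) => //.
  by move=> s; apply: sample_law_ge0.
have bound : \sum_s sample_law W s * g s <= 32 * d + (96 + #|L|%:R ^+ 2) / k%:R.
  apply: le_trans (expect_defect W1 Wsym V0 k0 h1 d0 Ud); rewrite exchange_big /=.
  apply: ler_sum => s _; rewrite mulr_suml; apply: ler_sum => phi _.
  by rewrite ler_wpM2l ?gle ?sample_prob_ge0.
have bound' : \sum_s sample_law W' s * g' s <= 32 * d + (96 + #|L|%:R ^+ 2) / k%:R.
  apply: le_trans (expect_defect W1' Wsym' V0' k0 h1' d0 Ud'); rewrite exchange_big /=.
  apply: ler_sum => s _; rewrite mulr_suml; apply: ler_sum => phi _.
  by rewrite ler_wpM2l ?gle' ?sample_prob_ge0.
have diff : \sum_s (sample_law W s - sample_law W' s) * g' s <=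
    20 * (eta * #|{ffun 'I_k * 'I_k -> bool}|%:R).
  have -> : 20 * (eta * #|{ffun 'I_k * 'I_k -> bool}|%:R) =
      \sum_(s : {ffun 'I_k * 'I_k -> bool}) eta * 20.
    by rewrite sumr_const -[RHS]mulr_natr; ring.
  apply: ler_sum => s _; apply: le_trans (ler_norm _) _; rewrite normrM.
  rewrite ler_pM ?sample_law_close // ger0_norm ?sample_defect_ge0 //.
  exact: sample_defect_le.
have -> : \sum_s sample_law W s * (g s + g' s) = \sum_s sample_law W s * g s +
    (\sum_s sample_law W' s * g' s + \sum_s (sample_law W s - sample_law W' s) * g' s).
  by rewrite -!big_split; apply: eq_bigr => s _ /=; ring.
lra.
Qed.

End CommonSample.

Lemma sample_defect_cut (V L : finType) (lab : V -> L) (h : L -> L -> R) phi s (r : R) :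
  0 <= r -> (0 < k)%N -> sample_defect (k := k) lab h phi s <= r ^+ 4 ->
  cut_le (sample_gap lab h phi s) (r * k%:R ^+ 2) /\ label_dist lab phi <= r ^+ 2.
Proof.
move=> r0 k0; have k_gt0 : 0 < k%:R :> R by rewrite ltr0n.
rewrite /sample_defect => le_r.
have c0 : 0 <= C4 (sample_gap lab h phi s) / k%:R ^+ 4.
  by rewrite divr_ge0 ?C4_ge0 ?exprn_ge0.
split.
  have := @cut_le_C4 R _ (sample_gap lab h phi s) r r0; rewrite card_ord; apply.
  rewrite exprMn -ler_pdivrMr ?exprn_gt0 //; apply: le_trans le_r.
  by rewrite lerDl sqr_ge0.
have ld0 : 0 <= label_dist lab phi :> R by apply: sumr_ge0 => l _; apply: normr_ge0.
rewrite -(@ler_pXn2r _ 2) ?nnegrE ?exprn_ge0 // -exprM.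
by apply: le_trans le_r; rewrite lerDr.
Qed.

End SampleLaw.

(** * Approximate pullbacks *)

Lemma class_freq_fst {R : realFieldType} (A L : finType) (a : A -> L) (c : nat) (l : L) :
  (0 < c)%N -> class_freq (fun p : A * 'I_c => a p.1) l = class_freq a l :> R.
Proof.
move=> c0; rewrite /class_freq card_prod card_ord /class_card.
rewrite (eq_card (_ : _ =i predX [pred x | a x == l] 'I_c)); last first.
  by move=> p; rewrite !inE andbT.
rewrite cardX card_ord !natrM.
have [->|A0] := eqVneq #|A| 0%N; first by rewrite !mul0r !invr0 !mulr0.
by field; rewrite !pnatr_eq0 A0 -lt0n c0.
Qed.

Lemma card_fiber_fst (A V : finType) (c : nat) (f : A -> V * 'I_c) (x : V) :
  injective f -> (#|[pred y | (f y).1 == x]| <= c)%N.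
Proof.
move=> finj; rewrite -[leqRHS]card_ord.
rewrite -(@card_in_image _ _ (fun y => (f y).2)); first exact: max_card.
move=> y y'; rewrite !inE => /eqP fy /eqP fy' eq2; apply: finj.
by move: fy fy' eq2; case: (f y) (f y') => [? ?] [? ?] /= -> -> ->.
Qed.

Lemma card_pred_inj (A B : finType) (f : A -> B) (P : pred B) :
  injective f -> (#|[pred y | P (f y)]| <= #|[pred z | P z]|)%N.
Proof.
move=> finj; rewrite -(fintype.card_image finj); apply: subset_leq_card.
by apply/fintype.subsetP => z /fintype.imageP[y]; rewrite !inE => Py ->.
Qed.

Section Transport.
Context {R : realFieldType} (k : nat) (V V' L : finType).
Context (W : V -> V -> R) (W' : V' -> V' -> R).
Context (lab : V -> L) (lab' : V' -> L) (h h' : L -> L -> R) (d r : R).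
Context (s : {ffun 'I_k * 'I_k -> bool}).
Context (phi : {ffun 'I_k -> V}) (phi' : {ffun 'I_k -> V'}).
Hypotheses (V0 : (0 < #|V|)%N) (k0 : (0 < k)%N) (kV : (k + #|V| <= #|V'|)%N).
Hypotheses (h1 : forall l l', `|h l l'| <= 1) (h1' : forall l l', `|h' l l'| <= 1).
Hypotheses (d0 : 0 <= d) (r0 : 0 <= r).
Hypothesis Ud : cut_le (fun x y => W x y - h (lab x) (lab y)) (d * #|V|%:R ^+ 2).
Hypothesis Ud' : cut_le (fun x y => W' x y - h' (lab' x) (lab' y)) (d * #|V'|%:R ^+ 2).
Hypothesis defect : sample_defect lab h phi s <= r ^+ 4.
Hypothesis defect' : sample_defect lab' h' phi' s <= r ^+ 4.
Notation n := #|V|.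
Notation m := #|V'|.

(* The map goes from [V'] to [V] through blow-ups of the common sample. *)
Lemma transport_map : exists (th : V' -> V) (c : nat),
  [/\ forall x, (#|[pred y | th y == x]| <= c)%N, (c * n <= m + k + n)%N
    & cut_le (fun y y' => W' y y' - W (th y) (th y'))
        ((5 * d + 12 * r ^+ 2 + 8 * r) * m%:R ^+ 2)].
Proof.
pose b i := lab (phi i); pose b' i := lab' (phi' i).
have [gap ld] := sample_defect_cut r0 k0 defect.
have [gap' ld'] := sample_defect_cut r0 k0 defect'.
(* Multiplicities of the blow-ups: [k * c1] exceeds [m] by at most [k], and [n * c2] exceeds
   [k * c1] by at most [n]. As k + n <= m, both lie between m and 2 m. *)
pose c1 := (m %/ k).+1; pose c2 := ((k * c1) %/ n).+1.
have kc1 : (m <= k * c1)%N by rewrite mulnC ltnW // ltn_ceil.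
have kc1' : (k * c1 <= m + k)%N.
  by rewrite /c1 mulnS addnC leq_add2r mulnC leq_trunc_div.
have nc2 : (k * c1 <= n * c2)%N by rewrite [leqRHS]mulnC ltnW // ltn_ceil.
have nc2' : (n * c2 <= k * c1 + n)%N.
  by rewrite /c2 mulnS addnC leq_add2r mulnC leq_trunc_div.
have [||f1 [f1inj f1m]] := @label_matching_freq R V' ('I_k * 'I_c1)%type L lab'
    (fun p => b' p.1) (r ^+ 2).
- by rewrite card_prod !card_ord.
- apply: le_trans ld'; rewrite le_eqVlt; apply/orP; left; apply/eqP.
  by apply: eq_bigr => l _; rewrite class_freq_fst // distrC.
have [||f2 [f2inj f2m]] := @label_matching_freq R ('I_k * 'I_c1)%type (V * 'I_c2)%type L
    (fun p => b p.1) (fun p => lab p.1) (r ^+ 2).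
- by rewrite !card_prod !card_ord.
- apply: le_trans ld; rewrite le_eqVlt; apply/orP; left; apply/eqP.
  by apply: eq_bigr => l _; rewrite !class_freq_fst.
pose psi y := (f1 y).1; pose th y := (f2 (f1 y)).1.
have th_fib x : (#|[pred y | th y == x]| <= c2)%N.
  by apply: (@card_fiber_fst _ _ _ (f2 \o f1)) => y y' /f2inj/f1inj.
have m0 : 0 <= m%:R :> R by rewrite ler0n.
have R1 : c1%:R * k%:R <= 2 * m%:R :> R.
  rewrite -!natrM ler_nat mulnC (leq_trans kc1') // mul2n -addnn leq_add2l.
  by apply: leq_trans kV; apply: leq_addr.
have R2 : c2%:R * n%:R <= 2 * m%:R :> R.
  rewrite -!natrM ler_nat mulnC (leq_trans nc2') // mul2n -addnn.
  by rewrite (leq_trans (leq_add kc1' (leqnn _))) // -addnA leq_add2l.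
have sq u v : 0 <= u -> u <= 2 * v -> u ^+ 2 <= 4 * v ^+ 2 :> R.
  move=> u0 uv; have -> : 4 * v ^+ 2 = (2 * v) ^+ 2 by ring.
  by rewrite ler_pXn2r ?nnegrE // (le_trans u0 uv).
exists th, c2; split=> //.
  by rewrite mulnC (leq_trans nc2') // leq_add2r.
(* The chain runs through W', h' lab', h' b' psi, X psi, h b psi, h lab th, W th. Its links cost d,
   4 r^2, 4 r, 4 r, 8 r^2 and 4 d, in units of m^2. *)
pose X := sign_kernel s : 'I_k -> 'I_k -> R.
have pull_psi (g : 'I_k -> 'I_k -> R) : cut_le g (r * k%:R ^+ 2) ->
    cut_le (fun y y' => g (psi y) (psi y')) (4 * r * m%:R ^+ 2).
  move=> gr; apply: (@cut_le_trans _ _ _ (c1%:R ^+ 2 * (r * k%:R ^+ 2))).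
    rewrite mulrCA -exprMn -mulrA [leRHS]mulrCA ler_wpM2l // sq // mulr_ge0 //.
  by apply: cut_le_pull gr => // i; rewrite ler_nat card_fiber_fst.
have T1 : cut_le (fun y y' => h' (lab' y) (lab' y') - h' (b' (psi y)) (b' (psi y')))
    (4 * 1 * (r ^+ 2 * m%:R) * m%:R).
  apply: (@cut_le_mismatch _ V' L h' lab' (fun y => b' (psi y))) => //.
  by apply: le_trans f1m; rewrite ler_nat; apply: subset_leq_card; apply/fintype.subsetP => y;
    rewrite !inE eq_sym.
have T2 : cut_le (fun y y' => h' (b' (psi y)) (b' (psi y')) - X (psi y) (psi y'))
    (4 * r * m%:R ^+ 2).
  by apply: cut_le_sub; apply: (pull_psi (sample_gap lab' h' phi' s)).
have T3 : cut_le (fun y y' => X (psi y) (psi y') - h (b (psi y)) (b (psi y')))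
    (4 * r * m%:R ^+ 2).
  by apply: (pull_psi (sample_gap lab h phi s)).
have T4 : cut_le (fun y y' => h (b (psi y)) (b (psi y')) - h (lab (th y)) (lab (th y')))
    (4 * 1 * (r ^+ 2 * (2 * m%:R)) * m%:R).
  apply: (@cut_le_mismatch _ V' L h (fun y => b (psi y)) (fun y => lab (th y))) => //.
  apply: (@le_trans _ _ (#|[pred p | lab (f2 p).1 != b p.1]|%:R)).
    rewrite ler_nat; apply: leq_trans (card_pred_inj (fun p => lab (f2 p).1 != b p.1) f1inj).
    by apply: subset_leq_card; apply/fintype.subsetP => y; rewrite !inE eq_sym.
  apply: le_trans f2m _; rewrite ler_wpM2l ?exprn_ge0 //.
  by rewrite card_prod !card_ord natrM mulrC.
have T5 : cut_le (fun y y' => h (lab (th y)) (lab (th y')) - W (th y) (th y'))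
    (4 * d * m%:R ^+ 2).
  apply: cut_le_sub; apply: (@cut_le_trans _ _ _ (c2%:R ^+ 2 * (d * n%:R ^+ 2))).
    by rewrite mulrCA -exprMn -mulrA [leRHS]mulrCA ler_wpM2l // sq // mulr_ge0.
  apply: (@cut_le_pull _ _ _ th (fun x y => W x y - h (lab x) (lab y))) => // x.
  by rewrite ler_nat.
have := cut_leB Ud' (cut_leB T1 (cut_leB T2 (cut_leB T3 (cut_leB T4 T5)))).
by apply: cut_le_trans; rewrite le_eqVlt; apply/orP; left; apply/eqP; ring.
Qed.

End Transport.

(** * Limits of sequences with explicit thresholds *)

Section Eventually.

Lemma cvgn_distP {R : realType} (u : nat -> R) (l : R) :
  (u @ \oo --> l)%classic <->
  forall e, 0 < e -> exists N, forall n, (N <= n)%N -> `|u n - l| <= e.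
Proof.
split=> [/cvgrPdist_le ul e e0|ul].
  by have [N _ HN] := ul e e0; exists N => n /HN /=; rewrite distrC.
apply/cvgrPdist_le => e /ul[N HN].
by exists N => // n /= /HN; rewrite distrC.
Qed.

Lemma cvgn_dist2 {R : realType} (u : nat -> R) (e : R) : cvgn u -> 0 < e ->
  exists N, forall n m, (N <= n)%N -> (N <= m)%N -> `|u n - u m| <= e.
Proof.
move=> /cvg_ex[l /cvgn_distP ul] e0.
have [N HN] := ul (e / 2) (divr_gt0 e0 (ltr0n _ 2)).
exists N => n m /HN un /HN um; apply: le_trans (ler_distD l _ _) _.
by rewrite [X in _ + X]distrC; lra.
Qed.

Lemma cvgn_of_dist2 {R : realType} (u : nat -> R) :
  (forall e, 0 < e -> exists N, forall n, (N <= n)%N -> `|u n - u N| <= e) -> cvgn u.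
Proof.
move=> ul; apply/cauchy_cvgP/cauchy_exP => e e0.
have [N HN] := ul (e / 2) (divr_gt0 e0 (ltr0n _ 2)).
exists (u N); exists N => // n /= /HN; rewrite /ball /= distrC => /le_lt_trans; apply.
by lra.
Qed.

Lemma fin_eventually (I : finType) (P : I -> nat -> Prop) :
  (forall i, exists N, forall n, (N <= n)%N -> P i n) ->
  exists N, forall n, (N <= n)%N -> forall i, P i n.
Proof.
move=> /choice[N HN]; exists (\max_i N i)%N => n le_n i.
by apply: HN; apply: leq_trans le_n; apply: leq_bigmax.
Qed.

Lemma card_eventually (V : nat -> finType) :
  ((fun n => #|V n|) @ \oo --> \oo)%classic ->
  forall A, exists N, forall n, (N <= n)%N -> (A <= #|V n|)%N.
Proof. by move=> /cvgnyPge cV A; have [N _ HN] := cV A; exists N => n /HN. Qed.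

Lemma natr_gt_exists {R : realType} (x : R) : exists A : nat, x < A%:R.
Proof. by exists (Num.trunc x).+1; apply: truncnS_gt. Qed.

End Eventually.

Lemma alpha_tot_card {R : realType} (V : finType) (G : wgraph R V) :
  (forall x, alpha G x = 1) -> alpha_tot G = #|V|%:R.
Proof.
by move=> alpha1; rewrite -sum1_card natr_sum; apply: eq_bigr => x _; apply: alpha1.
Qed.

(** * Sets of increasing pairs as simple graphs *)

Section EdgeGraphs.
Context (k : nat) (J : {set 'I_k * 'I_k}).
Hypothesis Jlt : forall e, e \in J -> (e.1 < e.2)%N.

Definition edge_rel : rel 'I_k := fun i j => ((i, j) \in J) || ((j, i) \in J).

Lemma edge_rel_sym : symmetric edge_rel.
Proof. by move=> i j; rewrite /edge_rel orbC. Qed.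

Lemma edge_rel_irrefl : irreflexive edge_rel.
Proof.
by move=> i; rewrite /edge_rel orbb; apply/negP => /Jlt; rewrite ltnn.
Qed.

Definition edge_graph := SGraph edge_rel_sym edge_rel_irrefl.

Lemma edge_density_hom {R : realType} (V : finType) (G : wgraph R V) :
  (forall x, alpha G x = 1) -> edge_density (beta G) J = hom_density edge_graph G.
Proof.
move=> alpha1; rewrite /hom_density /edge_density alpha_tot_card // card_ffun natrX.
congr (_^-1 * _); apply: eq_bigr => phi _.
rewrite [X in _ = X * _]big1 ?mul1r; last by move=> i _; apply: alpha1.
rewrite [LHS]big_mkcond [RHS]big_mkcond; apply: eq_bigr => -[i j] _ /=.
rewrite !enum_rank_ord /= /edge_rel /sample_weight /=.
case: (boolP ((i, j) \in J)) => [/Jlt /= -> //|ij] /=.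
case: (boolP ((j, i) \in J)) => //= /Jlt /=.
by case: ltngtP.
Qed.

End EdgeGraphs.

Lemma edge_density0 {R : realFieldType} (k : nat) (V : finType) (W : V -> V -> R)
    (J : {set 'I_k * 'I_k}) e : e \in J -> ~~ (e.1 < e.2)%N -> edge_density W J = 0.
Proof.
move=> eJ ne; rewrite /edge_density big1 ?mulr0 // => phi _.
by rewrite (bigD1 e) //= /sample_weight (negPf ne) mul0r.
Qed.

(** * Pullbacks along a left-convergent sequence *)

Section LeftConvergent.
Context {R : realType} (V : nat -> finType) (G : forall n, wgraph R (V n)).
Hypothesis alpha1 : forall n x, alpha (G n) x = 1.
Hypothesis beta_bound : forall n x y, -1 <= beta (G n) x y <= 1.
Hypothesis card_infty : ((fun n => #|V n|) @ \oo --> \oo)%classic.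
Hypothesis Gcvg : left_convergent G.

Lemma norm_beta_le1 n x y : `|beta (G n) x y| <= 1.
Proof. by rewrite ler_norml beta_bound. Qed.

Lemma edge_density_close (k : nat) (eta : R) : 0 < eta ->
  exists N, forall n m, (N <= n)%N -> (N <= m)%N -> forall J : {set 'I_k * 'I_k},
    `|edge_density (beta (G n)) J - edge_density (beta (G m)) J| <= eta.
Proof.
move=> eta0.
have [N HN] : exists N, forall n, (N <= n)%N -> forall J : {set 'I_k * 'I_k},
    forall m, (n <= m)%N ->
    `|edge_density (beta (G n)) J - edge_density (beta (G m)) J| <= eta.
  apply: fin_eventually => J.
  case: (boolP [exists e in J, ~~ (e.1 < e.2)%N]) => [/existsP[e /andP[eJ ne]]|].
    by exists 0%N => n _ m _; rewrite !(edge_density0 _ eJ ne) subrr normr0 ltW.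
  rewrite negb_exists => /forallP Jlt'.
  have Jlt e : e \in J -> (e.1 < e.2)%N.
    by move=> eJ; have := Jlt' e; rewrite eJ negbK.
  have [N HN] := cvgn_dist2 (@Gcvg (edge_graph Jlt)) eta0.
  exists N => n Nn m nm; rewrite !(edge_density_hom Jlt) //.
  by apply: HN => //; apply: leq_trans nm.
exists N => n m Nn Nm J; case: (leqP n m) => [|/ltnW] nm; first exact: HN.
by rewrite distrC; apply: HN.
Qed.

Lemma wgraph_card_gt0 n : (0 < #|V n|)%N.
Proof. exact: wgraph_nonempty (G n). Qed.

(** [N] depends only on [del], through the sample size [k] and the tolerance [eta]. [M] depends on
    [n] as well, since the rounding in the blow-ups is negligible only if [V m] is much larger than
    [V n]. *)
Lemma approximate_pullback (del : R) : 0 < del ->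
  exists N, forall n, (N <= n)%N -> exists M, forall m, (M <= m)%N ->
    exists (th : V m -> V n) (c : nat),
    [/\ forall x, (#|[pred y | th y == x]| <= c)%N,
        c%:R * #|V n|%:R <= (1 + del) * #|V m|%:R
      & cut_le (fun y y' => beta (G m) y y' - beta (G n) (th y) (th y'))
          (del * #|V m|%:R ^+ 2)].
Proof.
(* The transport error 5 d + 12 r^2 + 8 r is below 21 r. The choices of [d], [k] and [eta] bring the
   sum of the two defects below r^4, as 64/200 + 2/10 + 20/100 < 1. *)
move=> del0; pose r := Num.min del 1 / 30.
have r0 : 0 < r by rewrite divr_gt0 // lt_min del0 ltr01.
have rdel : 30 * r <= del by rewrite mulrC divfK // ge_min lexx.
have r1 : 30 * r <= 1 by rewrite mulrC divfK // ge_min lexx orbT.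
pose d := r ^+ 4 / 200; have d0 : 0 < d by rewrite divr_gt0 ?exprn_gt0.
have d2 : 0 < d / 2 by rewrite divr_gt0.
have [t ht] := natr_gt_exists ((d / 2) ^- 2).
pose Q := (4 ^ t)%N.
have reg n : exists (lab : V n -> 'I_Q) (h : 'I_Q -> 'I_Q -> R),
    (forall l l', `|h l l'| <= 1) /\
    cut_le (fun x y => beta (G n) x y - h (lab x) (lab y)) (d * #|V n|%:R ^+ 2).
  have [|lab [D [_ hD]]] := @weak_regularity R (V n) (beta (G n)) (d / 2)
    (norm_beta_le1 (n := n)) d2 t.
    rewrite -ler_pdivrMr ?exprn_gt0 // mul1r (le_trans (ltW ht)) //.
    by rewrite ler_nat.
  (* The sampling estimates require step values bounded by 1, which averages satisfy. Passing to
     them doubles the error [d / 2]. *)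
  exists lab, (class_avg lab (beta (G n))); split.
    by apply: class_avg_bound; apply: norm_beta_le1.
  have := cut_le_class_avg hD; rewrite [X in cut_le _ X]mulrA (_ : 2 * (d / 2) = d) //.
  by rewrite mulrC divfK.
have r4 : 0 < r ^+ 4 by rewrite exprn_gt0.
have [k' hk'] := natr_gt_exists (10 * (96 + Q%:R ^+ 2) / r ^+ 4).
pose k := k'.+1.
have hk : (96 + Q%:R ^+ 2) / k%:R <= r ^+ 4 / 10.
  rewrite ler_pdivrMr ?ltr0n // mulrAC ler_pdivlMr //.
  rewrite ltr_pdivrMr // in hk'; rewrite mulrC (le_trans (ltW hk')) //.
  by rewrite mulrC ler_wpM2l ?(ltW r4) // ler_nat.
pose K : R := #|{ffun 'I_k * 'I_k -> bool}|%:R.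
have K0 : 0 < K by rewrite ltr0n card_ffun card_bool expn_gt0.
pose eta := r ^+ 4 / (100 * K).
have eta0 : 0 < eta by rewrite divr_gt0 // mulr_gt0.
have [N HN] := edge_density_close k eta0.
exists N => n Nn.
have [A hA] := natr_gt_exists ((k + #|V n|)%:R / del).
have [M HM] := card_eventually card_infty (A + (k + #|V n|))%N.
exists (maxn N M) => m; rewrite geq_max => /andP[Nm /HM cardm].
have [lab [h [h1 hU]]] := reg n; have [lab' [h' [h1' hU']]] := reg m.
have [s [phi [phi' hs]]] := common_sample (norm_beta_le1 (n := n)) (beta_sym (G n))
  (norm_beta_le1 (n := m)) (beta_sym (G m)) (wgraph_card_gt0 n) (wgraph_card_gt0 m)
  (ltn0Sn k') h1 h1' (ltW d0) hU hU' (HN n m Nn Nm).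
have le_r4 : 2 * (32 * d + (96 + #|'I_Q|%:R ^+ 2) / k%:R) +
    20 * (eta * #|{ffun 'I_k * 'I_k -> bool}|%:R) <= r ^+ 4.
  rewrite card_ord -/K (_ : eta * K = r ^+ 4 / 100); last first.
    by rewrite /eta; field; rewrite gt_eqF.
  by rewrite /d; lra.
have {}hs := le_trans hs le_r4.
have [||th [c [fib cn cut]]] := transport_map (wgraph_card_gt0 n) (ltn0Sn k')
  (leq_trans (leq_addl _ _) cardm) h1 h1' (ltW d0) (ltW r0) hU hU'
  (s := s) (phi := phi) (phi' := phi').
- by apply: le_trans hs; rewrite lerDl sample_defect_ge0.
- by apply: le_trans hs; rewrite lerDr sample_defect_ge0.
exists th, c; split=> //.
  rewrite -natrM mulrDl mul1r (@le_trans _ _ (#|V m| + (k + #|V n|))%:R) //.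
    by rewrite ler_nat addnA.
  rewrite natrD lerD2l -ler_pdivrMl // mulrC (le_trans (ltW hA)) // ler_nat.
  by rewrite (leq_trans _ cardm) // leq_addr.
apply: cut_le_trans cut; rewrite ler_wpM2r ?exprn_ge0 //.
have r2 : r ^+ 2 <= r by rewrite expr2 ler_piMl ?(ltW r0) //; lra.
have r4' : r ^+ 4 <= r.
  rewrite -[leRHS]mul1r (exprSr r 3) ler_wpM2r ?(ltW r0) // exprn_ile1 ?(ltW r0) //; lra.
rewrite /d; lra.
Qed.

End LeftConvergent.

(** * Counting lemma *)

Section Counting.
Context {R : realFieldType} (T V : finType) (E : pred (T * T)).
Hypothesis Eneq : forall i j, E (i, j) -> i != j.
Hypothesis Easym : forall i j, E (i, j) -> ~~ E (j, i).
Context (W W' : V -> V -> R) (e : R).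
Hypotheses (W1 : forall x y, `|W x y| <= 1) (W1' : forall x y, `|W' x y| <= 1).
Hypothesis V0 : (0 < #|V|)%N.
Hypothesis close : cut_le (fun x y => W x y - W' x y) (e * #|V|%:R ^+ 2).
Notation n := (#|V|%:R : R).
Notation N := (#|{ffun T -> V}|%:R : R).

(** The kernel may vary with the edge, so that hybrids carrying [W'] on some edges and [W] on the
    others are covered. *)
Definition hom_sum (K : T * T -> V -> V -> R) : R :=
  \sum_(phi : {ffun T -> V}) \prod_(a | E a) K a (phi a.1) (phi a.2).

(** With the other nodes fixed, the remaining edges split into a function of the value at [i] (edges
    avoiding [j]) and one of the value at [j], because no second edge joins [i] and [j]. Both
    functions lie in [-1, 1]; signed test functions cost the factor 4. *)
Lemma hom_sum_swap (K K' : T * T -> V -> V -> R) (a0 : T * T) : E a0 ->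
  (forall a x y, `|K a x y| <= 1) -> K a0 = W -> K' a0 = W' ->
  (forall a, a != a0 -> K a = K' a) ->
  `|hom_sum K - hom_sum K'| <= 4 * e * N.
Proof.
case: a0 => i j Eij K1 Ka0 Ka0' Ka.
pose D x y := W x y - W' x y.
have ij := Eneq Eij.
pose X (phi : {ffun T -> V}) : R := D (phi i) (phi j) *
  \prod_(a | E a && (a != (i, j))) K a (phi a.1) (phi a.2).
have -> : hom_sum K - hom_sum K' = \sum_phi X phi.
  rewrite -sumrB; apply: eq_bigr => phi _.
  rewrite (bigD1 (i, j)) //= [X in _ - X](bigD1 (i, j)) //= Ka0 Ka0'.
  rewrite [X in _ - _ * X](eq_bigr (fun a => K a (phi a.1) (phi a.2))).
    by rewrite -mulrBl.
  by move=> a /andP[_ /Ka ->].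
have n0 : 0 < n by rewrite ltr0n.
have n2 : 0 < n ^+ 2 by rewrite exprn_gt0.
rewrite -(ler_pM2l n2) -{1}[n ^+ 2]gtr0_norm // -normrM.
have -> : n ^+ 2 * \sum_phi X phi =
    \sum_phi \sum_x \sum_y X (ffun_upd (ffun_upd phi i x) j y).
  by rewrite expr2 -mulrA (sum_resample j) (sum_resample i).
have -> : n ^+ 2 * (4 * e * N) = \sum_(phi : {ffun T -> V}) (4 * (e * n ^+ 2)).
  by rewrite sumr_const -[RHS]mulr_natr; ring.
apply: le_trans (ler_norm_sum _ _ _) _; apply: ler_sum => phi _.
pose f x := \prod_(a | [&& E a, a != (i, j) & ~~ ((a.1 == j) || (a.2 == j))])
  K a (ffun_upd phi i x a.1) (ffun_upd phi i x a.2).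
pose g y := \prod_(a | [&& E a, a != (i, j) & (a.1 == j) || (a.2 == j)])
  K a (ffun_upd phi j y a.1) (ffun_upd phi j y a.2).
have prod1 (P : pred (T * T)) (z : T * T -> R) : (forall a, `|z a| <= 1) ->
    `|\prod_(a | P a) z a| <= 1.
  by move=> z1; rewrite normr_prod; apply: prodr_ile1 => a _; rewrite normr_ge0 z1.
have f1 x : `|f x| <= 1 by apply: prod1 => a; apply: K1.
have g1 y : `|g y| <= 1 by apply: prod1 => a; apply: K1.
have -> : \sum_x \sum_y X (ffun_upd (ffun_upd phi i x) j y) = cut_form D f g.
  apply: eq_bigr => x _; apply: eq_bigr => y _.
  rewrite /X !ffunE !eqxx (negPf ij) mulrC; congr (_ * _).
  rewrite (bigID (fun a => (a.1 == j) || (a.2 == j))) /= mulrC; congr (_ * _).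
    rewrite /f (eq_bigl (fun a => [&& E a, a != (i, j) & ~~ ((a.1 == j) || (a.2 == j))])).
      by apply: eq_bigr => a /and3P[_ _]; rewrite negb_or !ffunE => /andP[/negPf -> /negPf ->].
    by move=> a; rewrite andbA.
  rewrite /g (eq_bigl (fun a => [&& E a, a != (i, j) & (a.1 == j) || (a.2 == j)])).
    apply: eq_bigr => -[p q] /and3P[/= Epq neq inj]; have pq := Eneq Epq.
    have [pi qi] : p != i /\ q != i.
      case/orP: inj => /eqP E1; rewrite {}E1 in Epq neq pq *; split.
      - by rewrite eq_sym.
      - by apply: contraTN Epq => /eqP ->; apply: Easym.
      - by apply: contraNneq neq => ->.
      - by rewrite eq_sym.
    by rewrite !ffunE (negPf pi) (negPf qi).
  by move=> a; rewrite andbA.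
exact: cut_le_signed.
Qed.

Lemma counting_lemma :
  `|hom_sum (fun=> W) - hom_sum (fun=> W')| <= 4 * e * N * #|E|%:R.
Proof.
pose K (s : seq (T * T)) a : V -> V -> R := if a \in s then W' else W.
have K1 s a x y : `|K s a x y| <= 1 by rewrite /K; case: ifP.
have H (s : seq (T * T)) : uniq s -> all E s ->
    `|hom_sum (fun=> W) - hom_sum (K s)| <= 4 * e * N * (size s)%:R.
  elim: s => [_ _|a s IH /= /andP[as_ us] /andP[Ea Es]].
    by rewrite subrr normr0 mulr0.
  apply: le_trans (ler_distD (hom_sum (K s)) _ _) _.
  rewrite /= -[(size s).+1%:R]natr1 mulrDr mulr1 lerD ?IH //.
  apply: (hom_sum_swap Ea) => //; rewrite /K.
  - by rewrite (negPf as_).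
  - by rewrite mem_head.
  - by move=> b ba; rewrite inE (negPf ba).
have := H (enum E) (enum_uniq E); rewrite -cardE.
have -> : hom_sum (K (enum E)) = hom_sum (fun=> W').
  apply: eq_bigr => phi _; apply: eq_bigr => a Ea.
  by rewrite /K mem_enum [a \in E]Ea.
by apply; apply/allP => a; rewrite mem_enum.
Qed.

End Counting.

(** * Densities as polynomials in the weights of a quotient *)

Section HomDensity.
Context {R : realType}.

Lemma edge_massE (V : finType) (G : wgraph R V) (S T : {set V}) :
  (forall x, alpha G x = 1) ->
  edge_mass G S T = \sum_(x in S) \sum_(y in T) beta G x y.
Proof.
move=> alpha1; apply: eq_bigr => x _; apply: eq_bigr => y _.
by rewrite !alpha1 !mul1r.
Qed.

Lemma alpha_setE (V : finType) (G : wgraph R V) (S : {set V}) :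
  (forall x, alpha G x = 1) -> alpha_set G S = #|S|%:R.
Proof.
by move=> alpha1; rewrite -sum1_card natr_sum; apply: eq_bigr => x _; apply: alpha1.
Qed.

Definition oriented_edge (F : sgraph) : pred (svertex F * svertex F) :=
  fun e => sedge e.1 e.2 && (enum_rank e.1 < enum_rank e.2)%N.

(** Homomorphism density into a graph of total nodeweight 1, on bare weights: a polynomial, so it
    passes to the limit. *)
Definition weighted_hom (F : sgraph) (q : nat) (a : 'I_q -> R) (b : 'I_q -> 'I_q -> R) : R :=
  \sum_(psi : {ffun svertex F -> 'I_q})
    (\prod_i a (psi i)) * \prod_(e | oriented_edge e) b (psi e.1) (psi e.2).

Lemma weighted_hom_cast (F : sgraph) (q q' : nat) (eq_q : q = q')
    (a : 'I_q' -> R) (b : 'I_q' -> 'I_q' -> R) :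
  weighted_hom F a b = weighted_hom F (a \o cast_ord eq_q)
    (fun i j => b (cast_ord eq_q i) (cast_ord eq_q j)).
Proof.
case: q' / eq_q a b => a b; apply: eq_bigr => psi _; congr (_ * _).
  by apply: eq_bigr => i _ /=; rewrite cast_ord_id.
by apply: eq_bigr => e _; rewrite !cast_ord_id.
Qed.

Lemma weighted_hom_cvg (F : sgraph) (q : nat) (a : nat -> 'I_q -> R)
    (b : nat -> 'I_q -> 'I_q -> R) (a0 : 'I_q -> R) (b0 : 'I_q -> 'I_q -> R) :
  (forall i, ((fun n => a n i) @ \oo --> a0 i)%classic) ->
  (forall i j, ((fun n => b n i j) @ \oo --> b0 i j)%classic) ->
  ((fun n => weighted_hom F (a n) (b n)) @ \oo --> weighted_hom F a0 b0)%classic.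
Proof.
move=> ca cb; apply: cvg_big => [|psi _]; first exact: add_continuous.
apply: cvgM; apply: cvg_big => [|i _].
- exact: mul_continuous.
- exact: ca.
- exact: mul_continuous.
- exact: cb.
Qed.

Section UnitWeights.
Context (V : finType) (G : wgraph R V) (P : lpartition V).
Hypothesis alpha1 : forall x, alpha G x = 1.
Hypothesis beta_bound : forall x y, -1 <= beta G x y <= 1.

Lemma quotient_alphaE i : alpha (quotient_graph G P) i = class_freq (label P) i.
Proof.
rewrite /= /quotient_alpha alpha_setE // alpha_tot_card // /class_freq /class_card.
by congr (_%:R / _); apply: eq_card => x; rewrite !inE.
Qed.

Lemma quotient_betaE i j :
  beta (quotient_graph G P) i j = class_avg (label P) (beta G) i j.
Proof.
have cardE l : #|pclass (P := P) l| = class_card (label P) l.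
  by apply: eq_card => x; rewrite !inE.
rewrite /= /quotient_beta edge_massE // !alpha_setE // !cardE /class_avg.
congr (_ / _); apply: eq_big => [x|x _]; first by rewrite inE.
by apply: eq_bigl => y; rewrite inE.
Qed.

Lemma weakly_regularP (eps : R) : 0 <= eps ->
  weakly_regular G P eps <-> cut_le (fun x y => beta G x y -
    class_avg (label P) (beta G) (label P x) (label P y)) (eps * #|V|%:R ^+ 2).
Proof.
move=> eps0.
have n2 : 0 < #|V|%:R ^+ 2 :> R by rewrite exprn_gt0 // ltr0n; apply: wgraph_nonempty G.
have E (S T : {set V}) : edge_mass G S T - edge_mass (averaged_graph G P) S T =
    \sum_(x in S) \sum_(y in T) (beta G x y -
      class_avg (label P) (beta G) (label P x) (label P y)).
  rewrite !edge_massE // -sumrB; apply: eq_bigr => x _; rewrite -sumrB.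
  by apply: eq_bigr => y _; rewrite -quotient_betaE.
rewrite /weakly_regular /cut_dist alpha_tot_card //; split.
  move=> /bigmax_leP[_ H]; apply: cut_le_set => S T; rewrite -E -ler_pdivrMr //.
  by have /bigmax_leP[_] := H S isT; apply.
move=> H; apply: bigmax_le => // S _; apply: bigmax_le => // T _.
by rewrite ler_pdivrMr // E; apply: cut_leP.
Qed.

Lemma norm_class_avg_le1 i j : `|class_avg (label P) (beta G) i j| <= 1.
Proof. by apply: class_avg_bound => x y; rewrite ler_norml. Qed.

Lemma hom_densityE (F : sgraph) : hom_density F G =
  hom_sum (oriented_edge (F := F)) (fun=> beta G) / #|{ffun svertex F -> V}|%:R.
Proof.
rewrite /hom_density alpha_tot_card // card_ffun natrX mulrC; congr (_ / _).
apply: eq_bigr => phi _.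
by rewrite [X in X * _]big1 ?mul1r // => i _; apply: alpha1.
Qed.

(** Maps are grouped by the labels they induce; those inducing [psi] choose their values freely in
    the classes [psi i]. *)
Lemma hom_sum_labelled (F : sgraph) (h : 'I_(nclass P) -> 'I_(nclass P) -> R) :
  hom_sum (oriented_edge (F := F)) (fun _ x y => h (label P x) (label P y)) =
  \sum_(psi : {ffun svertex F -> 'I_(nclass P)})
    (\prod_i (class_card (label P) (psi i))%:R) *
    \prod_(e | oriented_edge e) h (psi e.1) (psi e.2).
Proof.
rewrite /hom_sum.
pose lift (phi : {ffun svertex F -> V}) := [ffun i => label P (phi i)].
rewrite (partition_big lift predT) //=; apply: eq_bigr => psi _.
rewrite (eq_bigr (fun=> \prod_(e | oriented_edge e) h (psi e.1) (psi e.2))).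
  rewrite sumr_const -[LHS]mulr_natl; congr (_ * _).
  rewrite -natr_prod; congr (_%:R).
  have -> : (\prod_i class_card (label P) (psi i) =
      #|family (fun i => [pred x | label P x == psi i])|)%N.
    by rewrite card_family foldrE big_image.
  apply: eq_card => phi; rewrite -[LHS]/(lift phi == psi); apply/eqP/familyP => [E i|fam].
    by rewrite inE -E ffunE.
  by apply/ffunP => i; rewrite ffunE; apply/eqP; have := fam i; rewrite inE.
by move=> phi /eqP <-; apply: eq_bigr => e _; rewrite !ffunE.
Qed.

Lemma norm_beta_averaged_le1 x y : `|beta (averaged_graph G P) x y| <= 1.
Proof. by have := norm_class_avg_le1 (label P x) (label P y); rewrite -quotient_betaE. Qed.

End UnitWeights.

Lemma oriented_edge_neq (F : sgraph) (i j : svertex F) : oriented_edge (i, j) -> i != j.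
Proof. by move=> /andP[_ /=]; case: eqVneq => [->|//]; rewrite ltnn. Qed.

Lemma oriented_edge_asym (F : sgraph) (i j : svertex F) :
  oriented_edge (i, j) -> ~~ oriented_edge (j, i).
Proof.
move=> /andP[_ /= ij]; apply/negP => /andP[_ /= ji].
by have := ltn_trans ij ji; rewrite ltnn.
Qed.

Lemma hom_density_averaged (V : finType) (G : wgraph R V) (P : lpartition V) (F : sgraph) :
  (forall x, alpha G x = 1) -> hom_density F (averaged_graph G P) =
  weighted_hom F (alpha (quotient_graph G P)) (beta (quotient_graph G P)).
Proof.
move=> alpha1; rewrite hom_densityE //.
rewrite (hom_sum_labelled F (beta (quotient_graph G P))) mulr_suml.
apply: eq_bigr => psi _; rewrite mulrAC; congr (_ * _).
rewrite card_ffun natrX -prodr_const -prodf_div.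
by apply: eq_bigr => i _; rewrite quotient_alphaE.
Qed.

Lemma hom_density_quotient (V : finType) (G : wgraph R V) (P : lpartition V) (F : sgraph)
    (eps : R) : (forall x, alpha G x = 1) -> (forall x y, -1 <= beta G x y <= 1) ->
  0 <= eps -> weakly_regular G P eps ->
  `|hom_density F G -
    weighted_hom F (alpha (quotient_graph G P)) (beta (quotient_graph G P))| <=
  4 * eps * #|oriented_edge (F := F)|%:R.
Proof.
move=> alpha1 beta_bound eps0 /(weakly_regularP P alpha1 eps0) reg.
rewrite -hom_density_averaged // !hom_densityE // -mulrBl normrM.
have V0 := wgraph_nonempty G.
have N0 : 0 < #|{ffun svertex F -> V}|%:R :> R by rewrite ltr0n card_ffun expn_gt0 V0.
rewrite (@ger0_norm _ _^-1) ?invr_ge0 ?(ltW N0) // ler_pdivrMr // mulrAC.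
apply: counting_lemma => //; try exact: oriented_edge_neq; try exact: oriented_edge_asym.
- by move=> x y; rewrite ler_norml.
- exact: norm_beta_averaged_le1.
- by apply: cut_le_ext reg => x y; rewrite -quotient_betaE.
Qed.

Lemma left_convergent_of_quotients (V : nat -> finType) (G : forall n, wgraph R (V n)) :
  (forall n x, alpha (G n) x = 1) ->
  (forall n x y, -1 <= beta (G n) x y <= 1) ->
  ((fun n => #|V n|) @ \oo --> \oo)%classic ->
  (forall eps : R, 0 < eps -> exists (q : nat) (P : forall n, lpartition (V n)),
      (forall n, (q <= #|V n|)%N -> weakly_regular (G n) (P n) eps) /\
      exists H : wgraph R 'I_q, wgraph_cvg (fun n => quotient_graph (G n) (P n)) H) ->
  left_convergent G.
Proof.
move=> alpha1 beta_bound card_infty quot F; apply: cvgn_of_dist2 => e e0.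
set E := #|oriented_edge (F := F)|.
(* The counting error 4 eps |E| is then at most e / 4; the successor keeps the denominator positive.
   Three errors of this size are added in the end. *)
pose eps := e / (16 * E.+1%:R).
have eps0 : 0 < eps by rewrite divr_gt0 // mulr_gt0.
have [q [P [reg [H [N0 [kq [cva cvb]]]]]]] := quot eps eps0.
pose v n := weighted_hom F (alpha (quotient_graph (G n) (P n)))
  (beta (quotient_graph (G n) (P n))).
have vcvg : cvgn (fun n => v (n + N0)%N).
  apply/cvg_ex; exists (weighted_hom F (alpha H) (beta H)).
  under eq_fun => n do rewrite /v (weighted_hom_cast F (kq n)).
  by apply: weighted_hom_cvg.
have [N1 HN1] := cvgn_dist2 vcvg (divr_gt0 e0 (ltr0n R 4)).
have [N2 HN2] := card_eventually card_infty q.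
have uv n : (N2 <= n)%N -> `|hom_density F (G n) - v n| <= e / 4.
  move=> /HN2 /reg rg; apply: le_trans (hom_density_quotient F (alpha1 n) (beta_bound n)
    (ltW eps0) rg) _.
  have -> : e / 4 = 4 * eps * E.+1%:R.
    have : E.+1%:R != 0 :> R by rewrite pnatr_eq0.
    by rewrite /eps; move: (E.+1%:R : R) => u u0; field.
  apply: ler_wpM2l; first by rewrite mulr_ge0 // ltW.
  by rewrite ler_nat leqnSn.
pose M := (maxn N1 N2 + N0)%N.
have vv n m : (M <= n)%N -> (M <= m)%N -> `|v n - v m| <= e / 4.
  move=> Mn Mm; have N0n : (N0 <= n)%N by apply: leq_trans Mn; apply: leq_addl.
  have N0m : (N0 <= m)%N by apply: leq_trans Mm; apply: leq_addl.
  rewrite -(subnK N0n) -(subnK N0m); apply: HN1; rewrite leq_subRL //.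
    by rewrite addnC (leq_trans _ Mn) // leq_add2r leq_maxl.
  by rewrite addnC (leq_trans _ Mm) // leq_add2r leq_maxl.
have M2 : (N2 <= M)%N by rewrite (leq_trans (leq_maxr N1 N2)) // leq_addr.
exists M => n Mn.
have := uv n (leq_trans M2 Mn); have := uv M M2; have := vv n M Mn (leqnn M).
by rewrite !ler_norml => /andP[? ?] /andP[? ?] /andP[? ?]; apply/andP; split; lra.
Qed.

End HomDensity.

(** * Regular labellings *)

Section RegularLabels.
Context {R : realType}.

Definition regular_label (V : finType) (W : V -> V -> R) (q : nat) (lab : V -> 'I_q)
    (e : R) : Prop :=
  cut_le (fun x y => W x y - class_avg lab W (lab x) (lab y)) (e * #|V|%:R ^+ 2).

Lemma regularity_depth (eps : R) : 0 < eps -> exists t : nat,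
  (4 ^ t)%:R <= 2 `^ (10 / eps ^+ 2) /\ 1 <= t.+1%:R * (9 / 20 * eps) ^+ 2.
Proof.
move=> eps0; have e2 : 0 < eps ^+ 2 by rewrite exprn_gt0.
have q0 : 0 <= 5 / eps ^+ 2 by rewrite divr_ge0 // ltW.
have /andP[lo hi] := truncn_itv q0; set t := Num.trunc _ in lo hi.
exists t; split.
  rewrite natrX (_ : 4%:R = 2 ^+ 2); last by ring.
  rewrite -exprM -[2 ^+ (2 * t)]powR_mulrn //; apply: ler_powR; first by rewrite ler1n.
  rewrite natrM.
  apply: le_trans (_ : 2 * (5 / eps ^+ 2) <= _); first by rewrite ler_pM2l.
  by rewrite mulrA (_ : 2 * 5 = 10) //; ring.
move: hi; rewrite ltr_pdivrMr // exprMn => hi.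
by rewrite mulrCA -natr1; move: hi; rewrite -natr1 => hi; nra.
Qed.

(** Covers graphs with at least 4^t nodes that are too small for the asymptotic argument, since they
    need exactly 4^t classes too. Splitting classes until every label occurs keeps the step function
    and hence the cut bound, which averaging then doubles. *)
Lemma exact_regular_label (eps : R) (t : nat) (V : finType) (W : V -> V -> R) :
  0 < eps -> 1 <= t.+1%:R * (9 / 20 * eps) ^+ 2 -> (4 ^ t <= #|V|)%N ->
  (forall x y, `|W x y| <= 1) ->
  exists lab : V -> 'I_(4 ^ t),
    (forall i, exists x, lab x = i) /\ regular_label W lab eps.
Proof.
move=> eps0 ht qV W1.
have e0 : 0 < 9 / 20 * eps by rewrite mulr_gt0.
have [lab0 [D [_ hD]]] := weak_regularity W1 e0 ht.
have [lab [rho [surj E]]] := surjective_refinement lab0 qV.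
exists lab; split=> //.
have hD' : cut_le (fun x y => W x y - D (rho (lab x)) (rho (lab y)))
    (9 / 20 * eps * #|V|%:R ^+ 2).
  by apply: cut_le_ext hD => x y; rewrite !E.
have := cut_le_class_avg (D := fun i j => D (rho i) (rho j)) hD'.
apply: cut_le_trans; rewrite mulrA ler_wpM2r ?exprn_ge0 //; lra.
Qed.

(* A few nodes are redistributed evenly among the classes so that none is small;
   that costs little because the step function [D] is bounded in terms of [eps]. *)
Lemma large_regular_label (eps : R) (t : nat) :
  0 < eps -> 1 <= t.+1%:R * (9 / 20 * eps) ^+ 2 ->
  exists (A : nat) (c0 : R), [/\ 0 < c0, c0 <= 1 &
  forall (V : finType) (W : V -> V -> R), (A <= #|V|)%N ->
  (forall x y, `|W x y| <= 1) ->
  exists lab : V -> 'I_(4 ^ t),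
    (forall i, c0 <= class_freq lab i) /\
    regular_label W lab (19 / 20 * eps)].
Proof.
move=> eps0 ht; have e0 : 0 < 9 / 20 * eps by rewrite mulr_gt0.
pose q := (4 ^ t)%N; have q0 : (0 < q)%N by rewrite expn_gt0.
pose K := t%:R / (9 / 20 * eps).
have K0 : 0 <= K by rewrite divr_ge0 // ltW.
(* With this [A], relabelling [q * r] nodes costs at most eps / 40, and 2 (9/20 + 1/40) = 19/20. *)
have [A' hA'] := natr_gt_exists (160 * K * q%:R / eps).
pose A := (A' + q)%N.
have qA : (q <= A)%N by apply: leq_addl.
have A0 : (0 < A)%N by apply: leq_trans qA.
have AR : 0 < A%:R :> R by rewrite ltr0n.
have hA : 160 * K * q%:R <= eps * A%:R.
  by rewrite -ler_pdivrMl // mulrC (le_trans (ltW hA')) // ler_nat leq_addr.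
(* Each class will have at least [r] nodes, and r >= n / (2 A) because r >= 1 and n < (r + 1) A. *)
exists A, (2 * A%:R)^-1; split=> [||V W AV W1].
- by rewrite invr_gt0 mulr_gt0.
- by rewrite invf_le1 ?mulr_gt0 // -natrM ler1n muln_gt0 A0.
have [lab0 [D [D1 hD]]] := weak_regularity W1 e0 ht.
set n := #|V| in AV *; pose r := (n %/ A)%N.
have r0 : (0 < r)%N by rewrite divn_gt0.
have rA : (r * A <= n)%N by apply: leq_trunc_div.
have qr : (q * r <= n)%N by apply: leq_trans rA; rewrite mulnC leq_mul2l qA orbT.
(* The first [q * r] nodes receive the [q] labels cyclically, so each label gets [r] of them. *)
pose lab x : 'I_q := if (enum_rank x < q * r)%N
  then Ordinal (ltn_pmod (enum_rank x) q0) else lab0 x.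
exists lab.
have n0 : 0 < n%:R :> R by rewrite ltr0n (leq_trans A0).
have big i : (r <= class_card lab i)%N.
  have lt_rank (j : 'I_r) : (i + q * j < #|V|)%N.
    apply: leq_trans qr; rewrite -addSn.
    apply: (@leq_trans (q + q * j)); first by rewrite leq_add2r.
    by rewrite -mulnS leq_mul2l ltn_ord orbT.
  pose f (j : 'I_r) : V := enum_val (Ordinal (lt_rank j)).
  have finj : injective f.
    move=> j j' /enum_val_inj [] /eqP; rewrite eqn_add2l eqn_pmul2l // => /eqP.
    exact: val_inj.
  rewrite -[leqLHS]card_ord -(card_codom finj); apply: subset_leq_card.
  apply/fintype.subsetP => _ /codomP[j ->]; rewrite inE /lab /f enum_valK /=.
  have -> : (i + q * j < q * r)%N.
    apply: (@leq_trans (q + q * j)); first by rewrite -addSn leq_add2r.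
    by rewrite -mulnS leq_mul2l ltn_ord orbT.
  by rewrite -val_eqE /= addnC mulnC modnMDl modn_small.
split=> [i|].
  rewrite /class_freq -/n ler_pdivlMr // mulrC ler_pdivrMr ?mulr_gt0 //.
  apply: (@le_trans _ _ (r.+1 * A)%:R).
    by rewrite ler_nat ltnW // ltn_ceil.
  rewrite mulrA -(natrM _ _ 2) -natrM ler_nat leq_mul2r; apply/orP; right.
  by rewrite muln2 -addnn -addn1 leq_add ?big // (leq_trans r0 (big i)).
have mis : #|[pred x | lab0 x != lab x]|%:R <= (q * r)%:R :> R.
  rewrite ler_nat.
  have winj : injective (widen_ord qr) by move=> j j' /(congr1 val) /= /val_inj.
  rewrite -(fintype.card_image (@enum_rank_inj V) [pred x | lab0 x != lab x]).
  rewrite -[leqRHS]card_ord -(card_codom winj).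
  apply: subset_leq_card; apply/fintype.subsetP => _ /fintype.imageP[x xm ->].
  move: xm; rewrite !inE /lab; case: ifP => [lt_x _|_]; last by rewrite eqxx.
  by apply/codomP; exists (Ordinal lt_x); apply: val_inj.
have mm := cut_le_mismatch D1 mis.
have := @cut_le_class_avg R V _ lab W D _ (cut_leB hD mm).
apply: cut_le_trans; rewrite -/n -/K.
have qrn : 160 * K * (q * r)%:R <= eps * n%:R.
  rewrite natrM; apply: (@le_trans _ _ (eps * A%:R * r%:R)).
    by rewrite mulrA ler_wpM2r.
  by rewrite -mulrA ler_pM2l // -natrM ler_nat mulnC.
have : 160 * K * (q * r)%:R * n%:R <= eps * n%:R * n%:R by rewrite ler_wpM2r // ltW.
by move: (n%:R : R) ((q * r)%:R : R) => u v h; lra.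
Qed.

End RegularLabels.

(** * Pulling back regular labellings *)

Section TransportLabel.
Context {R : realType}.

Definition class_indicator (V L : finType) (lab : V -> L) (l : L) (x : V) : R :=
  (lab x == l)%:R.

Lemma class_indicator_unit (V L : finType) (lab : V -> L) (l : L) :
  unit_fun (class_indicator lab l).
Proof. by move=> x; rewrite /class_indicator; case: eqP; rewrite ?lexx ?ler01. Qed.

(** Clears denominators: the mass between two classes, unlike their average, is controlled directly
    by the cut norm. *)
Lemma class_avg_freq (V L : finType) (lab : V -> L) (W : V -> V -> R) (l l' : L) :
  0 < class_freq lab l :> R -> 0 < class_freq lab l' :> R ->
  class_avg lab W l l' * (class_freq lab l * class_freq lab l') =
  cut_form W (class_indicator lab l) (class_indicator lab l') / #|V|%:R ^+ 2.
Proof.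
move=> l0 l0'.
have -> : cut_form W (class_indicator lab l) (class_indicator lab l') =
    \sum_(x | lab x == l) \sum_(y | lab y == l') W x y.
  rewrite /cut_form [RHS]big_mkcond; apply: eq_bigr => x _.
  rewrite /class_indicator; case: (lab x == l); last first.
    by rewrite big1 // => y _; rewrite !mul0r.
  rewrite [RHS]big_mkcond; apply: eq_bigr => y _.
  by case: (lab y == l'); rewrite ?mul1r ?mulr0 ?mul0r.
have nz (k : L) : 0 < class_freq lab k :> R ->
    (class_card lab k)%:R != 0 :> R /\ #|V|%:R != 0 :> R.
  by rewrite /class_freq => k0; split; apply: contraTneq k0 => ->;
    rewrite ?mul0r ?invr0 ?mulr0 ltxx.
have [cl n0] := nz _ l0; have [cl' _] := nz _ l0'.
by rewrite /class_avg /class_freq; field; rewrite n0 cl cl'.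
Qed.

Section Pullback.
Context (V V' : finType) (W : V -> V -> R) (W' : V' -> V' -> R) (q : nat).
Context (lab : V -> 'I_q) (th : V' -> V) (c : nat) (del c0 : R).
Hypotheses (V0' : (0 < #|V'|)%N) (del0 : 0 <= del) (c00 : 0 < c0) (delc0 : del <= c0 / 2).
Hypothesis W1 : forall x y, `|W x y| <= 1.
Hypothesis fib : forall x, (#|[pred y | th y == x]| <= c)%N.
Hypothesis cn : c%:R * #|V|%:R <= (1 + del) * #|V'|%:R.
Hypothesis close : cut_le (fun y y' => W' y y' - W (th y) (th y')) (del * #|V'|%:R ^+ 2).
Hypothesis freq : forall i, c0 <= class_freq lab i.
Notation n := (#|V|%:R : R).
Notation m := (#|V'|%:R : R).
Notation lab' := (fun y => lab (th y)).

Let m0 : 0 < m. Proof. by rewrite ltr0n. Qed.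

Let V0 : (0 < #|V|)%N.
Proof. by have /card_gt0P[y _] := V0'; apply/card_gt0P; exists (th y). Qed.

Let n0 : 0 < n. Proof. by rewrite ltr0n. Qed.

(** Image under [th] of the uniform probability on [V'], to be compared with the uniform weight [v]
    on [V]. *)
Let w x : R := #|[pred y | th y == x]|%:R / m.
Let v : R := n^-1.

Let v0 : 0 <= v. Proof. by rewrite invr_ge0 ltW. Qed.
Let w0 x : 0 <= w x. Proof. by rewrite divr_ge0. Qed.

Let sum_w : \sum_x w x = 1.
Proof.
by rewrite -mulr_suml -natr_sum (sum_class_card th) divff // gt_eqF.
Qed.

Let sum_v : \sum_(x : V) v = 1.
Proof. by rewrite sumr_const -[LHS]mulr_natl divff // gt_eqF. Qed.

Let w_le x : w x <= (1 + del) * v.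
Proof.
rewrite /w /v ler_pdivlMr // mulrAC ler_pdivrMr //; apply: le_trans cn.
by rewrite ler_wpM2r // ler_nat.
Qed.

(** Both measures have mass 1, so the one-sided bound on [w] also limits where it falls short of
    [v]. *)
Let dev_w : \sum_x `|w x - v| <= 2 * del.
Proof.
apply: (@le_trans _ _ (\sum_x (((1 + del) * v - w x) + del * v))).
  apply: ler_sum => x _; have dv : 0 <= del * v by rewrite mulr_ge0.
  have := w_le x; rewrite mulrDl mul1r ler_norml => h; apply/andP; split; lra.
by rewrite big_split sumrB /= -!mulr_sumr sum_w sum_v; lra.
Qed.

Lemma class_freq_pull l : class_freq lab' l = \sum_(x | lab x == l) w x.
Proof.
rewrite /class_freq -mulr_suml; congr (_ / _); rewrite -natr_sum; congr (_%:R).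
rewrite /class_card -sum1_card (partition_big th (fun x => lab x == l)) //=.
apply: eq_bigr => x /eqP xl; rewrite -sum1_card; apply: eq_bigl => y.
by rewrite !inE; case: (eqVneq (th y) x) => [->|]; rewrite ?andbF // xl eqxx.
Qed.

Lemma class_freq_sum l : class_freq lab l = \sum_(x | lab x == l) v.
Proof. by rewrite sumr_const -[RHS]mulr_natl. Qed.

(** The upper bound for the union of the other classes provides the lower bound for the class
    [l]. *)
Lemma transport_freq l : `|class_freq lab' l - class_freq lab l| <= del.
Proof.
have le k : class_freq lab' k <= (1 + del) * class_freq lab k.
  rewrite class_freq_pull class_freq_sum mulr_sumr.
  by apply: ler_sum => x _; apply: w_le.
pose A : R := \sum_(k | k != l) class_freq lab k.
pose A' : R := \sum_(k | k != l) class_freq lab' k.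
have s1 : class_freq lab l + A = 1 by rewrite -(sum_class_freq lab V0) [RHS](bigD1 l).
have s1' : class_freq lab' l + A' = 1 by rewrite -(sum_class_freq lab' V0') [RHS](bigD1 l).
have rest : A' <= (1 + del) * A.
  by rewrite mulr_sumr; apply: ler_sum => k _; apply: le.
have A0 : 0 <= A by apply: sumr_ge0 => k _; apply: class_freq_ge0.
move: (le l) (class_freq_ge0 (R := R) lab l) s1 s1' rest A0.
move: (class_freq lab' l) (class_freq lab l) A A' => f' f u u' h1 h2 h3 h4 h5 h6.
by rewrite ler_norml; apply/andP; split; nra.
Qed.

(** One [del] for passing from [W'] to the pullback of [W], and 2 del in each variable for replacing
    [w] by [v]. *)
Let mass_dev l l' :
  `|cut_form W' (class_indicator lab' l) (class_indicator lab' l') / m ^+ 2 -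
    cut_form W (class_indicator lab l) (class_indicator lab l') / n ^+ 2| <= 5 * del.
Proof.
pose I k := class_indicator lab k; pose I' k := class_indicator lab' k.
have E1 : cut_form (fun y y' => W (th y) (th y')) (I' l) (I' l') / m ^+ 2 =
    cut_form W (fun x => w x * I l x) (fun x => w x * I l' x).
  rewrite cut_form_pull.
  have E k x : \sum_(y | th y == x) I' k y = m * (w x * I k x).
    rewrite (eq_bigr (fun=> I k x)); last by move=> y /eqP <-.
    by rewrite sumr_const -[LHS]mulr_natl /w mulrA mulrCA divff ?mulr1 // gt_eqF.
  rewrite (cut_form_extl W (E l) (E l')) cut_formZ -expr2 mulrC mulKf //.
  by rewrite expf_neq0 // gt_eqF.
have E2 : cut_form W (I l) (I l') / n ^+ 2 =
    cut_form W (fun x => v * I l x) (fun x => v * I l' x).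
  by rewrite cut_formZ /v; field; rewrite gt_eqF.
have d1 : `|cut_form W' (I' l) (I' l') / m ^+ 2 -
    cut_form W (fun x => w x * I l x) (fun x => w x * I l' x)| <= del.
  rewrite -E1 -mulrBl normrM (@ger0_norm _ (m ^- 2)) ?invr_ge0 ?exprn_ge0 ?(ltW m0) //.
  rewrite ler_pdivrMr ?exprn_gt0 //.
  have := close (class_indicator_unit lab' l) (class_indicator_unit lab' l').
  congr (`|_| <= _); rewrite /cut_form -sumrB; apply: eq_bigr => y _.
  by rewrite -sumrB; apply: eq_bigr => y' _; rewrite mulrBr.
have d2 : `|cut_form W (fun x => w x * I l x) (fun x => w x * I l' x) -
    cut_form W (fun x => v * I l x) (fun x => v * I l' x)| <= 4 * del.
  rewrite /cut_form -sumrB; apply: le_trans (ler_norm_sum _ _ _) _.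
  apply: (@le_trans _ _ (\sum_x \sum_x' (w x * `|w x' - v| + v * `|w x - v|))).
    apply: ler_sum => x _; rewrite -sumrB; apply: le_trans (ler_norm_sum _ _ _) _.
    apply: ler_sum => x' _.
    have -> : w x * I l x * (w x' * I l' x') * W x x' - v * I l x * (v * I l' x') * W x x'
      = (w x * (w x' - v) + v * (w x - v)) * (I l x * I l' x' * W x x') by ring.
    rewrite normrM -[leRHS]mulr1; apply: ler_pM => //.
      apply: le_trans (ler_normD _ _) _.
      by rewrite [`|w x * _|]normrM [`|v * _|]normrM (ger0_norm (w0 x)) (ger0_norm v0).
    have I1 k z : `|I k z| <= 1.
      have /andP[i0 i1] := class_indicator_unit lab k z.
      by rewrite ger0_norm.
    by rewrite !normrM !mulr_ile1 ?mulr_ge0 ?I1.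
  pose D := \sum_x `|w x - v|.
  have -> : \sum_x \sum_x' (w x * `|w x' - v| + v * `|w x - v|) =
      (\sum_x w x) * D + n * (v * D).
    rewrite mulr_suml {2}/D !mulr_sumr -big_split; apply: eq_bigr => x _ /=.
    by rewrite big_split sumr_const /= -mulr_sumr -[X in _ + X = _]mulr_natl.
  by rewrite sum_w mul1r mulrA divff ?gt_eqF // mul1r; have := dev_w; rewrite -/D; lra.
rewrite E2; apply: le_trans (ler_distD _ _ _) _.
apply: le_trans (lerD d1 d2) _; lra.
Qed.

(** The masses differ by at most 5 del and the products of frequencies by at most 2 del. So the
    averages differ by at most 7 del over the product of the new frequencies, each of which is at
    least c0 / 2. *)
Lemma transport_avg l l' :
  `|class_avg lab' W' l l' - class_avg lab W l l'| <= 28 * del / c0 ^+ 2.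
Proof.
have freq' k : c0 / 2 <= class_freq lab' k.
  have := transport_freq k; have := freq k; rewrite ler_norml => h /andP[h1 _].
  by move: delc0 => h2; lra.
have f0 k : 0 < class_freq lab k :> R by apply: lt_le_trans (freq k).
have f0' k : 0 < class_freq lab' k :> R.
  by apply: lt_le_trans (freq' k); rewrite divr_gt0.
have f1 k : class_freq lab k <= 1 :> R.
  rewrite -(sum_class_freq (R := R) lab V0) (bigD1 k) //= lerDl.
  by apply: sumr_ge0 => j _; apply: class_freq_ge0.
have f1' k : class_freq lab' k <= 1 :> R.
  rewrite -(sum_class_freq (R := R) lab' V0') (bigD1 k) //= lerDl.
  by apply: sumr_ge0 => j _; apply: class_freq_ge0.
have := mass_dev l l'; rewrite -!class_avg_freq //.
have := class_avg_bound lab W1 l l'.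
have := transport_freq l; have := transport_freq l'.
move: (f1 l) (f1 l') (f1' l) (f1' l') (f0' l) (f0' l') (freq' l) (freq' l') (f0 l) (f0 l').
move: (class_avg lab' W' l l') (class_avg lab W l l') => a' a.
move: (class_freq lab l) (class_freq lab l') (class_freq lab' l) (class_freq lab' l').
move=> f g f' g' hf1 hg1 hf1' hg1' f'0 g'0 f'c g'c hf0 hg0 dg df ha hE.
have fg : `|f * g - f' * g'| <= 2 * del.
  have -> : f * g - f' * g' = (f - f') * g + f' * (g - g') by ring.
  apply: le_trans (ler_normD _ _) _; rewrite !normrM (gtr0_norm hg0) (gtr0_norm f'0).
  rewrite distrC in df; rewrite distrC in dg.
  have -> : 2 * del = del * 1 + 1 * del by ring.
  by apply: lerD; apply: ler_pM => //; apply: ltW.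
have key : `|a' - a| * (f' * g') <= 7 * del.
  rewrite -(gtr0_norm (mulr_gt0 f'0 g'0)) -normrM.
  have -> : (a' - a) * (f' * g') = (a' * (f' * g') - a * (f * g)) + a * (f * g - f' * g').
    by ring.
  apply: le_trans (ler_normD _ _) _.
  have : `|a * (f * g - f' * g')| <= 1 * (2 * del) by rewrite normrM; apply: ler_pM.
  by lra.
rewrite ler_pdivlMr ?exprn_gt0 //.
have fgc : c0 ^+ 2 / 4 <= f' * g'.
  have -> : c0 ^+ 2 / 4 = (c0 / 2) * (c0 / 2) by field.
  by apply: ler_pM => //; rewrite divr_ge0 // ltW.
have : `|a' - a| * (c0 ^+ 2 / 4) <= 7 * del by apply: le_trans key; apply: ler_wpM2l.
lra.
Qed.

(** The terms are the pullback error, the old regularity carried along fibres of size at most (1 +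
    del) m / n, and the change of the averages. *)
Lemma transport_regular (e : R) : 0 <= e -> regular_label W lab e ->
  regular_label W' lab' (del + (1 + del) ^+ 2 * e + 28 * del / c0 ^+ 2).
Proof.
move=> e0 reg; set tau := 28 * del / c0 ^+ 2.
have c_gt0 : 0 < c%:R :> R.
  rewrite ltr0n; have /card_gt0P[y _] := V0'; apply: leq_trans (fib (th y)).
  by apply/card_gt0P; exists y; rewrite inE.
have T2 : cut_le (fun y y' => W (th y) (th y') - class_avg lab W (lab' y) (lab' y'))
    ((1 + del) ^+ 2 * e * m ^+ 2).
  have fibR x : #|[pred y | th y == x]|%:R <= c%:R :> R by rewrite ler_nat.
  apply: cut_le_trans (cut_le_pull c_gt0 fibR reg).
  rewrite mulrCA -exprMn [leRHS]mulrAC mulrC ler_wpM2r // -exprMn.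
  by rewrite ler_pXn2r ?nnegrE ?mulr_ge0 // addr_ge0.
have T3 : cut_le (fun y y' => class_avg lab W (lab' y) (lab' y') -
    class_avg lab' W' (lab' y) (lab' y')) (tau * m ^+ 2).
  apply: cut_le_sum.
  have -> : tau * m ^+ 2 = \sum_(y : V') \sum_(y' : V') tau.
    by rewrite !sumr_const -!mulrnA -[RHS]mulr_natr natrM expr2.
  by apply: ler_sum => y _; apply: ler_sum => y' _; rewrite distrC; apply: transport_avg.
have := cut_leB close (cut_leB T2 T3).
by apply: cut_le_trans; rewrite le_eqVlt; apply/orP; left; apply/eqP; ring.
Qed.

End Pullback.
End TransportLabel.

(** * Limit of the quotients *)

(** Compactness of the cube [-1, 1]^I, with [I] enumerated so that its points are row vectors. *)
Lemma bounded_cluster_point {R : realType} (I : finType) (u : nat -> I -> R) :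
  (forall n i, `|u n i| <= 1) -> exists p : I -> R,
    forall e : R, 0 < e -> forall N, exists2 n, (N <= n)%N & forall i, `|u n i - p i| <= e.
Proof.
move=> u1; pose v n : 'rV[R]_#|I| := \row_j u n (enum_val j).
pose A (j : 'I_#|I|) : set R := `[-1, 1]%classic.
have cA : compact [set w : 'rV[R]_#|I| | forall j, A j (w ord0 j)]%classic.
  by apply: rV_compact => j; apply: segment_compact.
have [|w [_ cw]] := cA (fmap v \oo)%classic _.
  exists 0%N => // n _ /= j; rewrite /A /= mxE in_itv /=.
  by rewrite -ler_norml.
exists (fun i => w ord0 (enum_rank i)) => e e0 N.
have [||w' [[n Nn <-] bn]] := cw (v @` [set n | (N <= n)%N])%classic (ball w e).
- by exists N => // n Nn /=; exists n.
- exact: nbhsx_ballx.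
exists n => // i; have := bn.2 ord0 (enum_rank i).
by rewrite mxE enum_rankK /ball /= distrC => /ltW.
Qed.

Section QuotientData.
Context {R : realType} {q : nat}.

(** Nodeweights and edgeweights form one family, so that a single cluster point serves both. *)
Definition quotient_index : finType := ('I_q + 'I_q * 'I_q)%type.

Definition quotient_data (V : finType) (W : V -> V -> R) (lab : V -> 'I_q)
    (i : quotient_index) : R :=
  match i with
  | inl l => class_freq lab l
  | inr (l, l') => class_avg lab W l l'
  end.

Lemma quotient_data_le1 (V : finType) (W : V -> V -> R) (lab : V -> 'I_q) i :
  (0 < #|V|)%N -> (forall x y, `|W x y| <= 1) -> `|quotient_data W lab i| <= 1.
Proof.
move=> V0 W1; case: i => [l|[l l']] /=; last exact: class_avg_bound.
rewrite ger0_norm ?class_freq_ge0 // -(sum_class_freq lab V0) (bigD1 l) //= lerDl.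
by apply: sumr_ge0 => k _; apply: class_freq_ge0.
Qed.

Definition quotient_dist (V : finType) (W : V -> V -> R) (lab : V -> 'I_q)
    (p : quotient_index -> R) : R :=
  \sum_i `|quotient_data W lab i - p i|.

End QuotientData.

Lemma class_avg_sym {R : realFieldType} (V L : finType) (lab : V -> L) (W : V -> V -> R) l l' :
  (forall x y, W x y = W y x) -> class_avg lab W l l' = class_avg lab W l' l.
Proof.
move=> Wsym; rewrite /class_avg exchange_big /= [X in _ / X]mulrC; congr (_ / _).
by apply: eq_bigr => x _; apply: eq_bigr => y _; apply: Wsym.
Qed.

(** The partition comes from a choice and is known only through an equation; substituting it turns
    the cast into the identity. *)
Lemma quotient_of_label {R : realType} (V : finType) (G : wgraph R V) (q : nat)
    (lab : V -> 'I_q) (surj : forall i, exists x, lab x = i)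
    (P : lpartition V) (kq : q = nclass P) :
  (forall x, alpha G x = 1) -> P = LPartition surj ->
  (forall i, alpha (quotient_graph G P) (cast_ord kq i) = class_freq lab i) /\
  (forall i j, beta (quotient_graph G P) (cast_ord kq i) (cast_ord kq j) =
    class_avg lab (beta G) i j).
Proof.
move=> alpha1 EP; subst P; rewrite /= in kq *; split=> [i|i j].
  by rewrite -[RHS](quotient_alphaE (P := LPartition surj) alpha1) cast_ord_id.
by rewrite -[RHS](quotient_betaE (P := LPartition surj) alpha1) !cast_ord_id.
Qed.

(** * Convergent quotients from left convergence *)

Section OnlyIf.
Context {R : realType} (V : nat -> finType) (G : forall n, wgraph R (V n)).
Hypothesis alpha1 : forall n x, alpha (G n) x = 1.
Hypothesis beta_bound : forall n x y, -1 <= beta (G n) x y <= 1.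
Hypothesis card_infty : ((fun n => #|V n|) @ \oo --> \oo)%classic.
Hypothesis Gcvg : left_convergent G.
Context (eps : R) (t : nat).
Hypotheses (eps0 : 0 < eps) (ht : 1 <= t.+1%:R * (9 / 20 * eps) ^+ 2).
Notation q := (4 ^ t)%N.
Notation W n := (beta (G n)).

Let W1 n x y : `|W n x y| <= 1. Proof. exact: norm_beta_le1. Qed.
Let V0 n : (0 < #|V n|)%N. Proof. exact: wgraph_nonempty (G n). Qed.

(* [p] lists the weights of the limit graph; it is a cluster point of the
   quotients of well-chosen partitions, and pulling these partitions back
   brings all later quotients close to it. *)
Lemma limit_quotient : exists p : quotient_index (q := q) -> R,
  [/\ forall l, 0 < p (inl l), forall l l', p (inr (l, l')) = p (inr (l', l))
    & forall tau : R, 0 < tau -> exists N, forall m, (N <= m)%N ->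
        exists lab : V m -> 'I_q,
        [/\ forall l, exists x, lab x = l, regular_label (W m) lab eps
          & forall i, `|quotient_data (W m) lab i - p i| <= tau]].
Proof.
have [A [c0 [c00 c01 large]]] := @large_regular_label R eps t eps0 ht.
have [N0 HN0] := card_eventually card_infty A.
have ex n : {lab : V (N0 + n)%N -> 'I_q | (forall i, c0 <= class_freq lab i) /\
    regular_label (W (N0 + n)%N) lab (19 / 20 * eps)}.
  by apply: cid; apply: large => //; apply: HN0; apply: leq_addr.
pose lab n := sval (ex n).
have [freq reg] : (forall n i, c0 <= class_freq (lab n) i) /\
    forall n, regular_label (W (N0 + n)%N) (lab n) (19 / 20 * eps).
  by split=> n; have [] := svalP (ex n).
pose u n := quotient_data (W (N0 + n)%N) (lab n).
have [p Hp] : exists p : quotient_index (q := q) -> R, forall e : R, 0 < e -> forall N,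
    exists2 n, (N <= n)%N & forall i, `|u n i - p i| <= e.
  by apply: bounded_cluster_point => n i; apply: quotient_data_le1.
exists p; split.
- move=> l; have [n _ /(_ (inl l))] := Hp (c0 / 2) (divr_gt0 c00 (ltr0n _ 2)) 0%N.
  by rewrite ler_norml /= => /andP[_]; have := freq n l; move: c00; lra.
- move=> l l'; apply/eqP; rewrite -subr_eq0 -normr_le0; apply/ler_addgt0Pr => e e0.
  have [n _ close] := Hp (e / 2) (divr_gt0 e0 (ltr0n _ 2)) 0%N.
  have := close (inr (l, l')); have := close (inr (l', l)).
  rewrite /u /= (class_avg_sym _ l' l (beta_sym (G (N0 + n)%N))) !ler_norml.
  by move=> /andP[? ?] /andP[? ?]; apply/andP; split; lra.
move=> tau tau0.
have [b [b0 btau beps bc0]] : exists b : R, [/\ 0 < b, b <= tau, b <= eps & b <= c0].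
  exists (Num.min (Num.min tau eps) c0); split; last by rewrite !ge_min lexx orbT.
  - by rewrite !lt_min tau0 eps0 c00.
  - by rewrite !ge_min lexx.
  - by rewrite !ge_min lexx orbT.
(* Then 28 del / c0^2 = b / 25: the averages move by less than tau / 2, and the regularity grows
   from 19/20 eps to at most eps. *)
pose del := b * c0 ^+ 2 / 700.
have del0 : 0 < del := divr_gt0 (mulr_gt0 b0 (exprn_gt0 2 c00)) (ltr0n R 700).
have del_tau : 28 * del / c0 ^+ 2 = 28 * b / 700.
  by rewrite /del; field; rewrite gt_eqF.
have del_b : del <= b / 700.
  rewrite ler_pM2r ?invr_gt0 ?ltr0n //.
  by rewrite ler_piMr ?(ltW b0) // exprn_ile1 // ltW.
have [N1 HN1] := approximate_pullback alpha1 beta_bound card_infty Gcvg del0.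
(* A single graph beyond [N1] with quotient near [p] is fixed; its labels are pulled back to all
   [V m] with [m] beyond the [M] belonging to it. *)
have [n nN1 close] := Hp (tau / 2) (divr_gt0 tau0 (ltr0n _ 2)) N1.
have [M HM] := HN1 (N0 + n)%N (leq_trans nN1 (leq_addl _ _)).
exists M => m /HM[th [c [fib cn cut]]].
have delc0 : del <= c0 / 2 by lra.
have W1n k x y : `|W k x y| <= 1 by apply: W1.
have del0' := ltW del0.
have tfreq l : `|class_freq (fun y => lab n (th y)) l - class_freq (lab n) l| <= del.
  exact: transport_freq fib cn l.
have tavg l l' : `|class_avg (fun y => lab n (th y)) (W m) l l' -
    class_avg (lab n) (W (N0 + n)%N) l l'| <= 28 * del / c0 ^+ 2.
  exact: transport_avg (fib) cn cut (freq n) l l'.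
exists (fun y => lab n (th y)); split.
- move=> l; have : 0 < class_freq (fun y => lab n (th y)) l :> R.
    by have := tfreq l; have := freq n l; rewrite ler_norml => ? /andP[? _]; lra.
  rewrite /class_freq; case: (pickP [pred y | lab n (th y) == l]) => [y /eqP yl _|no].
    by exists y.
  by rewrite /class_card (eq_card0 no) mul0r ltxx.
- have e19 : 0 <= 19 / 20 * eps by rewrite mulr_ge0 // ltW.
  have : regular_label (W m) (fun y => lab n (th y))
      (del + (1 + del) ^+ 2 * (19 / 20 * eps) + 28 * del / c0 ^+ 2).
    exact: (transport_regular (V0 m) del0' c00 delc0 (@W1n _) fib cn cut (freq n) e19 (reg n)).
  apply: cut_le_trans; rewrite ler_wpM2r ?exprn_ge0 // del_tau.
  have sq : (1 + del) ^+ 2 <= 1 + 3 * del by nra.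
  have : (1 + del) ^+ 2 * (19 / 20 * eps) <= (1 + 3 * del) * (19 / 20 * eps).
    by rewrite ler_wpM2r.
  have : del * eps <= 1 / 700 * eps by rewrite ler_pM2r //; lra.
  by lra.
move=> i; apply: le_trans (ler_distD (u n i) _ _) _.
have -> : tau = tau / 2 + tau / 2 by lra.
apply: lerD (close i); case: i => [l|[l l']] /=.
  by apply: le_trans (tfreq l) _; lra.
by apply: le_trans (tavg l l') _; rewrite del_tau; lra.
Qed.

(** There are finitely many labellings, so some regular one has its quotient nearest to [p]. Being
    optimal it serves every tolerance at once, which avoids a diagonal choice over [tau]. Below [q]
    nodes the partition into singletons is a default value. *)
Lemma best_partition (p : quotient_index (q := q) -> R) n : exists P : lpartition (V n),
  (q <= #|V n|)%N -> exists (lab : V n -> 'I_q) (surj : forall i, exists x, lab x = i),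
    [/\ P = LPartition surj, regular_label (W n) lab eps
      & forall lab' : V n -> 'I_q, (forall i, exists x, lab' x = i) ->
          regular_label (W n) lab' eps ->
          quotient_dist (W n) lab p <= quotient_dist (W n) lab' p].
Proof.
case: (leqP q #|V n|) => [qV|_]; last first.
  have surj (i : 'I_#|V n|) : exists x, enum_rank x = i.
    by exists (enum_val i); rewrite enum_valK.
  by exists (LPartition surj).
pose good (f : {ffun V n -> 'I_q}) :=
  `[< (forall i, exists x, f x = i) /\ regular_label (W n) f eps >].
have goodE (lab : V n -> 'I_q) : (forall i, exists x, lab x = i) ->
    regular_label (W n) lab eps -> good [ffun x => lab x].
  have E : [ffun x => lab x] = lab :> (V n -> 'I_q) by apply/funext => x; rewrite ffunE.
  by move=> surj reg; apply/asboolP; rewrite E.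
have [lab0 [surj0 reg0]] := exact_regular_label eps0 ht qV (@W1 n).
have := goodE _ surj0 reg0; set f0 := (X in good X) => good0.
have := @arg_minP _ _ _ f0 good (fun f => quotient_dist (W n) f p) good0.
case=> f /asboolP[surj reg] min_f.
exists (LPartition surj) => _; exists f, surj; split=> // lab' surj' reg'.
have E : [ffun x => lab' x] = lab' :> (V n -> 'I_q) by apply/funext => x; rewrite ffunE.
by have := min_f _ (goodE _ surj' reg'); rewrite E.
Qed.

Lemma convergent_quotients : exists P : forall n, lpartition (V n),
  (forall n, (q <= #|V n|)%N -> nclass (P n) = q /\ weakly_regular (G n) (P n) eps) /\
  exists H : wgraph R 'I_q, wgraph_cvg (fun n => quotient_graph (G n) (P n)) H.
Proof.
have [p [p0 psym plim]] := limit_quotient.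
pose P n := sval (cid (best_partition p n)).
have HP n : (q <= #|V n|)%N ->
    exists (lab : V n -> 'I_q) (surj : forall i, exists x, lab x = i),
    [/\ P n = LPartition surj, regular_label (W n) lab eps
      & forall lab' : V n -> 'I_q, (forall i, exists x, lab' x = i) ->
          regular_label (W n) lab' eps ->
          quotient_dist (W n) lab p <= quotient_dist (W n) lab' p].
  exact: svalP (cid (best_partition p n)).
have nclassP n : (q <= #|V n|)%N -> nclass (P n) = q.
  by move=> /HP[lab [surj [-> _ _]]].
exists P; split.
  move=> n qV; split; first exact: nclassP.
  have [lab [surj [-> reg _]]] := HP n qV.
  exact/(weakly_regularP (LPartition surj) (@alpha1 n) (ltW eps0)).
have q0 : (0 < #|'I_q|)%N by rewrite card_ord expn_gt0.
exists (WGraph q0 p0 psym).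
have [N0 HN0] := card_eventually card_infty q.
have kq n : q = nclass (P (n + N0)%N).
  by apply/esym/nclassP/HN0; apply: leq_addl.
have close e : 0 < e -> exists N, forall n, (N <= n)%N ->
    (forall i, `|alpha (quotient_graph (G (n + N0)%N) (P (n + N0)%N)) (cast_ord (kq n) i) -
       p (inl i)| <= e) /\
    (forall i j, `|beta (quotient_graph (G (n + N0)%N) (P (n + N0)%N)) (cast_ord (kq n) i)
       (cast_ord (kq n) j) - p (inr (i, j))| <= e).
  (* Optimality concerns the sum over all weights, so each weight of the competing labelling is
     taken within e / c of the limit. *)
  move=> e0; pose c : R := #|quotient_index (q := q)|.+1%:R.
  have c0 : 0 < c by rewrite ltr0n.
  have [N HN] := plim (e / c) (divr_gt0 e0 c0); exists N => n Nn.
  have qV : (q <= #|V (n + N0)%N|)%N by apply: HN0; apply: leq_addl.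
  have [l0 [surj [EP _ best]]] := HP _ qV.
  have [l1 [surj1 reg1 near1]] := HN (n + N0)%N (leq_trans Nn (leq_addr _ _)).
  have dist1 : quotient_dist (W (n + N0)%N) l0 p <= e.
    apply: le_trans (best l1 surj1 reg1) _.
    apply: (@le_trans _ _ (\sum_(i : quotient_index (q := q)) e / c)).
      by apply: ler_sum => i _; apply: near1.
    rewrite sumr_const -[leLHS]mulr_natl mulrA ler_pdivrMr // mulrC ler_pM2l //.
    by rewrite ler_nat leqnSn.
  have each i : `|quotient_data (W (n + N0)%N) l0 i - p i| <= e.
    apply: le_trans dist1; rewrite /quotient_dist (bigD1 i) //= lerDl.
    by apply: sumr_ge0 => j _; apply: normr_ge0.
  have [ha hb] := quotient_of_label (kq n) (@alpha1 _) EP.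
  by split=> [i|i j]; rewrite ?ha ?hb; [apply: (each (inl i))|apply: (each (inr (i, j)))].
exists N0, kq; split=> [i|i j]; apply/cvgn_distP => e /close[N HN]; exists N => n /HN[ha hb].
  exact: ha.
exact: hb.
Qed.

End OnlyIf.

Local Open Scope classical_set_scope.
Local Open Scope ring_scope.

Theorem theorem2p8 (R : realType) (V : nat -> finType)
    (G : forall n, wgraph R (V n))
    (alpha1 : forall n x, alpha (G n) x = 1)
    (beta_bound : forall n x y, -1 <= beta (G n) x y <= 1)
    (card_infty : (fun n => #|V n|) @ \oo --> \oo) :
  left_convergent G <->
  forall eps : R, 0 < eps ->
    exists (q : nat) (P : forall n, lpartition (V n)),
      [/\ q%:R <= 2 `^ (10 / eps ^+ 2) :> R,
          forall n, (q <= #|V n|)%N ->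
            nclass (P n) = q /\ weakly_regular (G n) (P n) eps
        & exists H : wgraph R 'I_q,
            wgraph_cvg (fun n => quotient_graph (G n) (P n)) H].
Proof.
split=> [Gcvg eps eps0|quot].
  have [t [qle ht]] := regularity_depth eps0.
  have [P [reg lim]] := convergent_quotients alpha1 beta_bound card_infty Gcvg eps0 ht.
  by exists (4 ^ t)%N, P; split.
apply: left_convergent_of_quotients => // eps eps0.
have [q [P [_ reg lim]]] := quot eps eps0.
by exists q, P; split=> // n /reg[].
Qed.
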